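(* For any two positive integers $k \geq 2$ and $1 \leq \ell \leq k-1$, there is a permutation $\pi$ of length $k$ with $m(\pi) = \ell$, for which the optimal one-sided non-adaptive $\varepsilon$-test for $\pi$-freeness makes $\tilde{\Theta}_{\varepsilon}\!\left(n^{1-1/\ell}\right)$ queries, where the $\tilde{\Theta}_\varepsilon$ notation hides a multiplicative term polynomial in $\log n$ and $\varepsilon$.
   Context: For a permutation $\pi=(\pi_1,\dots,\pi_k)$ of $[k]$, $m(\pi)=\max_{1\le i\le k-1}|\pi_{i+1}-\pi_i|$. A sequence $f\colon[n]\to\mathbb{R}$ contains $\pi$ if there are $i_1<\dots<i_k$ with $f(i_a)<f(i_b)$ iff $\pi_a<\pi_b$; else it is $\pi$-free. $f$ is $\varepsilon$-far from $\pi$-freeness if more than $\varepsilon n$ values must be changed to make it $\pi$-free. A one-sided $\varepsilon$-test always accepts $\pi$-free inputs and rejects $\varepsilon$-far inputs with probability $\ge 2/3$; non-adaptive means all queries are chosen before any answer. The optimal test is one of minimum query complexity (maximum number of queries); $k$ is regarded as a constant. *)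

(* Defs.v *)
From HB Require Import structures.
From mathcomp Require Import all_boot all_order all_algebra all_fingroup.
From mathcomp Require Import reals exp.

Set Implicit Arguments.
Unset Strict Implicit.
Unset Printing Implicit Defensive.

Import Order.TTheory GRing.Theory Num.Theory.
Local Open Scope ring_scope.

(* Permutations of [k] are 0-based here, which leaves all differences and
   comparisons of values unchanged. *)
Definition max_jump (k : nat) (pi : 'S_k) : nat :=
  (\max_(i < k) \max_(j < k | (j : nat) == i.+1)
     `|(pi j : nat)%:Z - (pi i : nat)%:Z|)%N.

Definition contains_pattern (R : realType) (k n : nat) (pi : 'S_k)
    (f : 'I_n -> R) : Prop :=
  exists i : 'I_k -> 'I_n,
    (forall a b : 'I_k, (a < b)%N -> (i a < i b)%N) /\
    (forall a b : 'I_k, f (i a) < f (i b) <-> (pi a < pi b)%N).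

Definition pattern_free (R : realType) (k n : nat) (pi : 'S_k)
    (f : 'I_n -> R) : Prop :=
  ~ contains_pattern pi f.

Definition far_from_free (R : realType) (k n : nat) (pi : 'S_k) (eps : R)
    (f : 'I_n -> R) : Prop :=
  forall g : 'I_n -> R, pattern_free pi g ->
    eps * n%:R < #|[set i | f i != g i]|%:R.

(* A non-adaptive randomized algorithm on inputs 'I_n -> R first draws the set
   Q of queried positions, and then, seeing only the answers on Q, rejects with
   a probability depending on Q and on these answers.  Since there are finitely
   many query sets, this covers every source of internal randomness. *)
Record nonadaptive_algorithm (R : realType) (n : nat) := NonadaptiveAlgorithm {
  query_prob : {set 'I_n} -> R;
  query_prob_ge0 : forall Q, 0 <= query_prob Q;
  query_prob_sum1 : \sum_(Q : {set 'I_n}) query_prob Q = 1;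
  decision : forall Q : {set 'I_n}, ({i : 'I_n | i \in Q} -> R) -> R;
  decision_prob : forall (Q : {set 'I_n}) (answers : {i : 'I_n | i \in Q} -> R),
    0 <= decision answers <= 1
}.

Definition reject_prob (R : realType) (n : nat) (T : nonadaptive_algorithm R n)
    (f : 'I_n -> R) : R :=
  \sum_(Q : {set 'I_n})
     query_prob T Q * decision T (fun i : {i : 'I_n | i \in Q} => f (val i)).

Definition num_queries (R : realType) (n : nat)
    (T : nonadaptive_algorithm R n) : nat :=
  (\max_(Q : {set 'I_n} | query_prob T Q != 0%R) #|Q|)%N.

Definition one_sided_test (R : realType) (k n : nat) (pi : 'S_k) (eps : R)
    (T : nonadaptive_algorithm R n) : Prop :=
  (forall f : 'I_n -> R, pattern_free pi f -> reject_prob T f = 0) /\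
  (forall f : 'I_n -> R, far_from_free pi eps f -> 2 / 3 <= reject_prob T f).

Definition optimal_test (R : realType) (k n : nat) (pi : 'S_k) (eps : R)
    (T : nonadaptive_algorithm R n) : Prop :=
  one_sided_test pi eps T /\
  (forall T' : nonadaptive_algorithm R n,
     one_sided_test pi eps T' -> (num_queries T <= num_queries T')%N).

Definition optimal_query_complexity (R : realType) (k : nat) (pi : 'S_k)
    (q : nat -> R -> nat) : Prop :=
  forall (n : nat) (eps : R), 0 < eps < 1 ->
    exists T : nonadaptive_algorithm R n,
      optimal_test pi eps T /\ num_queries T = q n eps.

(* The hidden factor is at most C * (log n / eps) ^ a in either direction; any
   polynomial in log n and 1 / eps is of this form for n >= 3 and eps < 1.
   The constants and the threshold n0 do not depend on n or eps.  The lower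
   bound concerns small eps only: for eps close to 1, far inputs may be
   scarce, or absent. *)
Definition soft_Theta_eps (R : realType) (q : nat -> R -> nat)
    (g : nat -> R) : Prop :=
  exists (C eps0 : R) (a n0 : nat),
    [/\ 0 < C,
        0 < eps0 < 1,
        forall (n : nat) (eps : R), (n0 <= n)%N -> 0 < eps < 1 ->
          (q n eps)%:R <= C * (ln n%:R / eps) ^+ a * g n
      & forall (n : nat) (eps : R), (n0 <= n)%N -> 0 < eps <= eps0 ->
          g n <= C * (ln n%:R / eps) ^+ a * (q n eps)%:R].

(* Main.v *)
(* The pattern is 0, 1, ..., r-1, k-1, k-2, ..., r with r = k - l.

   Upper bound. A far input has a linear number of disjoint copies. Activate
   each position independently with probability about n^(-1/l), query the active
   positions, and from each of them also query a random walk of r steps to the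
   left, each step going to a uniform point of the previous dyadic cell at a
   random scale. For most copies t, the walk started at role r of t finds, with
   probability polynomial in eps / log n, an increasing chain below the lowest
   value of the roles r, ..., k-1 of t. So it suffices that these l positions
   are all active, which happens for some such t, by independence over the
   disjoint copies.

   Lower bound. A one-sided test rejects only if it has queried a copy. In the
   hard inputs, an adjacent pair plays roles r-1 and r, and the values between
   the two force the roles r+1, ..., k-1 to come from the same copy, in l-1
   blocks that are shifted independently. A query set Q determines the shifts
   from at most |Q|^l tuples, so it catches at most |Q|^l of the N^(l-1) inputs. *)
Require Import Defs.
From mathcomp Require Import all_boot all_order all_algebra all_fingroup.
From mathcomp Require Import boolp reals exp.
From mathcomp Require Import zify ring lra.

Set Implicit Arguments.
Unset Strict Implicit.
Unset Printing Implicit Defensive.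

Import Order.TTheory GRing.Theory Num.Theory.
Local Open Scope ring_scope.

(** * Copies inside a query set, and disjoint copies in far inputs *)

Section Copies.
Variables (R : realType) (k n : nat) (pi : 'S_k).
Implicit Types (f g : 'I_n -> R) (Q : {set 'I_n}).

Definition is_copy f (i : 'I_k -> 'I_n) : Prop :=
  (forall a b : 'I_k, (a < b)%N -> (i a < i b)%N) /\
  (forall a b : 'I_k, f (i a) < f (i b) <-> (pi a < pi b)%N).

Definition copy_in f Q : Prop :=
  exists2 i : 'I_k -> 'I_n, is_copy f i & forall a, i a \in Q.

Lemma copy_inj f i : is_copy f i -> injective i.
Proof.
case=> inc _ a b eq_i; apply/val_inj/eqP; rewrite eqn_leq.
by apply/andP; split; rewrite leqNgt; apply/negP => /inc; rewrite eq_i ltnn.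
Qed.

Lemma is_copyP f (i : 'I_k -> 'I_n) :
  (forall a b : 'I_k, (a < b)%N -> (i a < i b)%N) ->
  (forall a b : 'I_k, (pi a < pi b)%N -> f (i a) < f (i b)) -> is_copy f i.
Proof.
move=> inc ord; split=> // a b; split; last exact: ord.
move=> fab; rewrite ltnNge leq_eqVlt; apply/negP => /orP[/eqP/val_inj/perm_inj ba|].
  by rewrite ba ltxx in fab.
by move=> /ord /(lt_trans fab); rewrite ltxx.
Qed.

(** [rho] sends a point to the nearest point of [Q] at or to the left of it, or to the minimum of
    [Q] if there is none. *)
Lemma retract_exists Q (q0 : 'I_n) : q0 \in Q ->
  exists rho : 'I_n -> 'I_n, [/\ forall i, rho i \in Q,
    forall i, i \in Q -> rho i = i & forall i j : 'I_n, (i <= j)%N -> (rho i <= rho j)%N].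
Proof.
move=> q0Q; pose qmin := [arg min_(q < q0 in Q) (q : nat)].
have [qminQ qminP] : qmin \in Q /\ forall q, q \in Q -> (qmin <= q)%N.
  by rewrite /qmin; case: arg_minnP.
pose rho i := if (qmin <= i)%N
  then [arg max_(q > qmin in [set q in Q | (q <= i)%N]) (q : nat)] else qmin.
have rhoP i : (qmin <= i)%N -> [/\ rho i \in Q, (rho i <= i)%N &
    forall q, q \in Q -> (q <= i)%N -> (q <= rho i)%N].
  move=> le_i; rewrite /rho le_i.
  case: arg_maxnP => [|q]; first by rewrite inE qminQ.
  rewrite inE => /andP[qQ qi] qmax; split=> // q' q'Q q'i.
  by apply: qmax; rewrite inE q'Q.
exists rho; split.
- move=> i; have [/rhoP[]//|lt_i] := leqP qmin i.
  by rewrite /rho leqNgt lt_i.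
- move=> i iQ; have [_ le1 le2] := rhoP _ (qminP i iQ).
  by apply/val_inj/eqP; rewrite eqn_leq le1 /= le2.
- move=> i j ij; have [le_i|lt_i] := leqP qmin i.
    have [iQ le1 _] := rhoP i le_i.
    have [_ _] := rhoP j (leq_trans le_i ij); apply=> //.
    exact: leq_trans le1 ij.
  rewrite [rho i]/rho ifN -?ltnNge //; apply: qminP.
  have [/rhoP[]//|lt_j] := leqP qmin j.
  by rewrite /rho leqNgt lt_j.
Qed.

(* Outside Q, repeat the value of a neighbouring point of Q. *)
Lemma copy_in_extend f Q : (1 < k)%N -> exists g,
  (forall i, i \in Q -> g i = f i) /\ (contains_pattern pi g -> copy_in f Q).
Proof.
move=> k_gt1; have [->|[q0 q0Q]] := set_0Vmem Q.
  exists (fun=> 0); split=> [i|[i [_ ord]]]; first by rewrite inE.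
  pose a := (pi^-1)%g (Ordinal (ltnW k_gt1)); pose b := (pi^-1)%g (Ordinal k_gt1).
  by have := (ord a b).2; rewrite !permKV ltxx /= => /(_ isT).
have [rho [rhoQ rho_id rho_inc]] := retract_exists q0Q.
exists (f \o rho); split=> [i iQ|[i [inc ord]]] /=; first by rewrite rho_id.
exists (rho \o i) => [|a]; last exact: rhoQ.
split=> [a b ab|]; last exact: ord.
(* The monotone map [rho] could merge two roles only if these had equal values, but distinct roles
   have distinct values. *)
rewrite ltn_neqAle rho_inc 1?ltnW ?inc // andbT; apply/negP => /eqP/val_inj /= eq_rho.
have [pab|] := ltnP (pi a) (pi b).
  by move/ord: pab; rewrite /= eq_rho ltxx.
rewrite leq_eqVlt => /orP[/eqP/val_inj/perm_inj ba|/ord]; last by rewrite /= eq_rho ltxx.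
by rewrite ba ltnn in ab.
Qed.

(** A maximum family of disjoint copies meets every copy, so overwriting its at most [k * #|M|]
    positions by nearby outside values destroys all copies. *)
Lemma far_disjoint_copies eps f : (1 < k)%N -> far_from_free pi eps f ->
  exists M : {set {ffun 'I_k -> 'I_n}},
    [/\ forall t, t \in M -> is_copy f t,
        forall t t' (a a' : 'I_k), t \in M -> t' \in M -> t a = t' a' -> t = t'
      & eps * n%:R < k%:R * #|M|%:R].
Proof.
move=> k_gt1 far.
pose P (M : {set {ffun 'I_k -> 'I_n}}) := `[< (forall t, t \in M -> is_copy f t) /\
  (forall t t' (a a' : 'I_k), t \in M -> t' \in M -> t a = t' a' -> t = t') >].
have P0 : P set0 by apply/asboolP; split=> t; rewrite inE.
case: (arg_maxnP (fun M : {set {ffun 'I_k -> 'I_n}} => #|M|) P0) => M /asboolP[Mcopy Mdisj] Mmax.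
exists M; split=> //.
pose U := [set (p : {ffun 'I_k -> 'I_n} * 'I_k).1 p.2 | p in setX M [set: 'I_k]].
have [g [gE gfree]] := copy_in_extend f (~: U) k_gt1.
apply: lt_le_trans (far g _) _.
  case/gfree=> i icopy iU.
  pose t0 : {ffun 'I_k -> 'I_n} := [ffun a => i a].
  have t0E a : t0 a \notin U by rewrite ffunE; have := iU a; rewrite inE.
  have UE t a : t \in M -> t a \in U.
    by move=> tM; apply/imsetP; exists (t, a); rewrite ?inE ?tM.
  have t0M : t0 \notin M.
    apply/negP => tM; have := t0E (Ordinal (ltnW k_gt1)).
    by rewrite UE.
  suff : P (t0 |: M) by move/Mmax; rewrite cardsU1 t0M add1n /= ltnn.
  apply/asboolP; split=> [t|t t' a a'].
    rewrite !inE => /orP[/eqP ->|]; last exact: Mcopy.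
    case: icopy => inc ord.
    by split=> [a b|a b]; rewrite !ffunE; [apply: inc|apply: ord].
  rewrite !inE => /orP[/eqP ->|tM] /orP[/eqP ->|t'M] //.
  - by move=> eq_t; have := t0E a; rewrite eq_t UE.
  - by move=> eq_t; have := t0E a'; rewrite -eq_t UE.
  - exact: Mdisj.
rewrite -natrM ler_nat; apply: (@leq_trans #|U|).
  apply/subset_leq_card/subsetP => i; rewrite inE; apply: contraR => iU.
  by rewrite gE ?inE.
by rewrite (leq_trans (leq_imset_card _ _)) // cardsX cardsT card_ord mulnC.
Qed.
End Copies.

(** * Non-adaptive tests *)

Section Tests.
Variables (R : realType) (k n : nat) (pi : 'S_k).
Hypothesis k_gt1 : (1 < k)%N.
Implicit Types (f g : 'I_n -> R) (Q : {set 'I_n}) (eps : R).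

(** Some pattern-free input gives the same answers on [Q], and one-sidedness forbids any chance of
    rejecting it. *)
Lemma decision_no_copy eps (T : nonadaptive_algorithm R n) f Q :
  one_sided_test pi eps T -> query_prob T Q != 0 -> ~ copy_in pi f Q ->
  decision T (fun i : {i : 'I_n | i \in Q} => f (val i)) = 0.
Proof.
case=> sound _ pQ nocopy; have [g [gE gfree]] := copy_in_extend pi f Q k_gt1.
have /sound /eqP : pattern_free pi g by move/gfree.
rewrite psumr_eq0 => [/allP/(_ Q (mem_index_enum _)) /=|Q' _]; last first.
  rewrite mulr_ge0 ?query_prob_ge0 //.
  by case/andP: (decision_prob T (fun i : {i : 'I_n | i \in Q'} => g (val i))).
rewrite mulf_eq0 (negPf pQ) /= => /eqP <-; congr (decision _ _).
by apply/funext => -[i iQ] /=; rewrite gE.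
Qed.

(** The counterpart of [copy_in] in terms of the answers alone, as a decision rule requires. *)
Definition answers_contain Q (v : {i : 'I_n | i \in Q} -> R) : Prop :=
  exists i : 'I_k -> {i : 'I_n | i \in Q},
    (forall a b : 'I_k, (a < b)%N -> (val (i a) < val (i b))%N) /\
    (forall a b : 'I_k, v (i a) < v (i b) <-> (pi a < pi b)%N).

Lemma answers_containP f Q :
  answers_contain (fun i : {i : 'I_n | i \in Q} => f (val i)) <-> copy_in pi f Q.
Proof.
split=> [[i [inc ord]]|[i [inc ord] iQ]].
  by exists (fun a => val (i a)) => // a; apply: valP.
by exists (fun a => exist _ (i a) (iQ a)).
Qed.

(** The test draws [w] uniformly and rejects exactly when a copy is visible in [S w], which makes it
    one-sided. *)
Lemma test_of_sampler eps (Om : finType) (om0 : Om) (S : Om -> {set 'I_n}) (b : nat) :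
    (forall w, #|S w| <= b)%N ->
    (forall f, far_from_free pi eps f ->
       2 / 3 * #|Om|%:R <= #|[set w | `[< copy_in pi f (S w) >]]|%:R :> R) ->
  exists T : nonadaptive_algorithm R n, one_sided_test pi eps T /\ (num_queries T <= b)%N.
Proof.
move=> Sb Sfar.
have Om_gt0 : 0 < #|Om|%:R :> R by rewrite ltr0n; apply/card_gt0P; exists om0.
pose p Q : R := #|[set w | S w == Q]|%:R / #|Om|%:R.
have p_ge0 Q : 0 <= p Q by rewrite divr_ge0.
have p_sum (h : {set _} -> R) : \sum_Q p Q * h Q = (\sum_w h (S w)) / #|Om|%:R.
  rewrite mulr_suml (partition_big S xpredT) //=; apply: eq_bigr => Q _.
  rewrite /p mulrAC -sum1_card natr_sum !mulr_suml.
  apply: eq_big => [w|w]; first by rewrite inE.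
  by rewrite inE => /eqP ->; rewrite mul1r.
have p_sum1 : \sum_Q p Q = 1.
  have := p_sum (fun=> 1); under eq_bigr do rewrite mulr1.
  by move=> ->; rewrite sumr_const cardT -cardE divff ?gt_eqF.
pose d Q (v : {i : 'I_n | i \in Q} -> R) : R := `[< answers_contain v >]%:R.
have d_prob Q v : 0 <= @d Q v <= 1 by rewrite /d; case: asboolP; rewrite ?ler01 ?lexx.
pose T := NonadaptiveAlgorithm p_ge0 p_sum1 d_prob.
have rejE f : reject_prob T f = #|[set w | `[< copy_in pi f (S w) >]]|%:R / #|Om|%:R.
  rewrite /reject_prob /= p_sum; congr (_ / _).
  rewrite -sum1_card natr_sum [RHS]big_mkcond /=; apply: eq_bigr => w _.
  by rewrite /d inE (asbool_equiv_eq (answers_containP f (S w))); case: asbool.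
exists T; split; last first.
  apply/bigmax_leqP => Q; rewrite /= /p mulf_eq0 negb_or => /andP[+ _].
  rewrite pnatr_eq0 -lt0n => /card_gt0P[w]; rewrite inE => /eqP <-; exact: Sb.
split=> f Hf; rewrite rejE.
  apply/eqP; rewrite mulf_eq0 pnatr_eq0 cards_eq0; apply/orP; left.
  by apply/eqP/setP => w; rewrite !inE; apply/asboolP => -[i icopy _]; apply: Hf; exists i.
by rewrite ler_pdivlMr // Sfar.
Qed.

(** Shows that some test exists, so that an optimal one does, and serves as the test for small
    [n]. *)
Lemma full_query_test eps : 0 < eps ->
  exists T : nonadaptive_algorithm R n, one_sided_test pi eps T /\ (num_queries T <= n)%N.
Proof.
move=> eps_gt0; apply: (@test_of_sampler _ unit tt (fun=> [set: 'I_n])) => [_|f far].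
  by rewrite cardsT card_ord.
have ->: [set w : unit | `[< copy_in pi f [set: 'I_n] >]] = setT.
  apply/setP => w; rewrite !inE; apply/asboolP.
  case: (pselect (contains_pattern pi f)) => [[i icopy]|/far].
    by exists i => // a; rewrite inE.
  have ->: [set i | f i != f i] = set0 by apply/setP => i; rewrite !inE eqxx.
  by rewrite cards0 => /(le_lt_trans _); move/(_ 0 (mulr_ge0 (ltW eps_gt0) (ler0n _ _))); rewrite ltxx.
rewrite cardsT card_unit; lra.
Qed.

End Tests.

Lemma optimal_complexity_exists (R : realType) (k : nat) (pi : 'S_k) : (1 < k)%N ->
  exists q : nat -> R -> nat, optimal_query_complexity pi q.
Proof.
move=> k_gt1.
have opt (x : nat * R) : exists m, 0 < x.2 < 1 ->
    exists T : nonadaptive_algorithm R x.1, optimal_test pi x.2 T /\ num_queries T = m.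
  (* Outside [0 < eps < 1] the value 0 is a placeholder. *)
  case: x => n eps /=; have [/andP[eps_gt0 _]|_] := boolP (0 < eps < 1); last by exists 0%N.
  have ex_m : exists m, `[< exists2 T : nonadaptive_algorithm R n,
      one_sided_test pi eps T & num_queries T = m >].
    have [T [Tos _]] := full_query_test n pi eps_gt0.
    by exists (num_queries T); apply/asboolP; exists T.
  case: (ex_minnP ex_m) => m /asboolP[T Tos Tm] m_min.
  exists m => _; exists T; split=> //; split=> // T' T'os.
  by rewrite Tm; apply: m_min; apply/asboolP; exists T'.
have [q qP] := choice opt.
by exists (fun n eps => q (n, eps)) => n eps /(qP (n, eps)).
Qed.

(** * Independence in product spaces *)

Section Mean.
Variables (R : realType) (Om : finType).
Implicit Types X Y : Om -> R.

Definition mean X : R := (\sum_w X w) / #|Om|%:R.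

Lemma meanD X Y : mean (fun w => X w + Y w) = mean X + mean Y.
Proof. by rewrite /mean big_split mulrDl. Qed.

Lemma meanZ c X : mean (fun w => c * X w) = c * mean X.
Proof. by rewrite /mean -mulr_sumr mulrA. Qed.

Lemma mean_sum (J : finType) (P : pred J) (X : J -> Om -> R) :
  mean (fun w => \sum_(j | P j) X j w) = \sum_(j | P j) mean (X j).
Proof. by rewrite /mean exchange_big mulr_suml. Qed.

Lemma le_mean X Y : (forall w, X w <= Y w) -> mean X <= mean Y.
Proof. by move=> XY; rewrite ler_wpM2r ?invr_ge0 // ler_sum. Qed.

Lemma mean_cst (w0 : Om) c : mean (fun=> c) = c.
Proof.
rewrite /mean sumr_const cardT -cardE -[c *+ _]mulr_natr mulfK // pnatr_eq0 -lt0n.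
by apply/card_gt0P; exists w0.
Qed.

Lemma mean_indicator (P : pred Om) :
  mean (fun w => (P w)%:R) = #|[set w | P w]|%:R / #|Om|%:R.
Proof.
rewrite /mean -sum1_card natr_sum [in RHS]big_mkcond; congr (_ / _).
by apply: eq_bigr => w _; rewrite inE; case: (P w).
Qed.

End Mean.

Section ProductSpace.
Variables (R : realType) (I A : finType) (a0 : A).
Notation Om := {ffun I -> A}.
Implicit Types (X Y : Om -> R) (S : {set I}).

Definition depends_on S X : Prop :=
  forall w w' : Om, {in S, w =1 w'} -> X w = X w'.

Let Om_neq0 : #|{: Om}|%:R != 0 :> R.
Proof. by rewrite pnatr_eq0 -lt0n; apply/card_gt0P; exists [ffun=> a0]. Qed.

Lemma mean_mul_disjoint S S' X Y : depends_on S X -> depends_on S' Y ->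
  [disjoint S & S'] -> mean (fun w => X w * Y w) = mean X * mean Y.
Proof.
move=> Xdep Ydep disj.
pose mix (w w' : Om) : Om := [ffun i => if i \in S then w i else w' i].
(* Exchanging the coordinates in S makes the two factors use the same point. *)
pose swap (p : Om * Om) := (mix p.1 p.2, mix p.2 p.1).
have swapK : involutive swap.
  case=> w w'; rewrite /swap /mix /=.
  by congr (_, _); apply/ffunP => i; rewrite !ffunE; case: (i \in S).
have key : (\sum_w X w) * (\sum_w Y w) = #|{: Om}|%:R * \sum_w X w * Y w.
  rewrite mulr_suml; under eq_bigr do rewrite mulr_sumr.
  rewrite pair_big /= (reindex_inj (inv_inj swapK)) /=.
  transitivity (\sum_(p : Om * Om) X p.1 * Y p.1).
    apply: eq_bigr => -[w w'] _ /=; congr (_ * _).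
      by apply: Xdep => i iS; rewrite ffunE iS.
    apply: Ydep => i iS'; rewrite ffunE ifN //.
    by apply: contraL iS' => iS; rewrite (disjointFr disj iS).
  rewrite -(pair_big xpredT xpredT (fun w w' => X w * Y w)) /=.
  by rewrite mulr_sumr; apply: eq_bigr => w _; rewrite sumr_const cardT -cardE mulr_natl.
by rewrite /mean mulrACA key mulrACA divff // mul1r.
Qed.

(** Induction: the product over the tail depends only on the union of its sets, which is disjoint
    from the set of the head. *)
Lemma mean_prod_disjoint (J : eqType) (s : seq J) (S : J -> {set I}) (X : J -> Om -> R) :
    uniq s -> {in s, forall j, depends_on (S j) (X j)} ->
    {in s &, forall j j', j != j' -> [disjoint S j & S j']} ->
  mean (fun w => \prod_(j <- s) X j w) = \prod_(j <- s) mean (X j).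
Proof.
elim: s => [_ _ _|j s IH /= /andP[js us] Xdep disj].
  by under eq_fun do rewrite big_nil; rewrite big_nil (mean_cst [ffun=> a0]).
have jin : j \in j :: s by rewrite mem_head.
have sin j' : j' \in s -> j' \in j :: s by rewrite inE orbC => ->.
under eq_fun do rewrite big_cons.
rewrite big_cons -IH => // [|j' /sin|j1 j2 /sin + /sin]; [|exact: Xdep|exact: disj].
apply: (@mean_mul_disjoint (S j) [set i | has (fun j' => i \in S j') s]) => [||].
- exact: Xdep.
- move=> w w' eq_w; apply: eq_big_seq => j' j's.
  apply: (Xdep _ (sin _ j's)) => i iS; apply: eq_w.
  by rewrite inE; apply/hasP; exists j'.
- rewrite disjoint_sym disjoint_subset; apply/subsetP => i; rewrite inE => /hasP[j' j's iS].
  rewrite inE; apply: contraL iS => iS; rewrite (disjointFr (disj _ _ jin (sin _ j's) _) iS) //.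
  by apply: contraNneq js => ->.
Qed.

(** The sum over [Om] factors over the coordinates. The factor [P] of the other coordinates does not
    depend on [psi], so it cancels against the case [psi = 1]. *)
Lemma mean_coord i (phi : A -> R) :
  mean (fun w : Om => phi (w i)) = mean phi.
Proof.
pose F (psi : A -> R) (j : I) (a : A) := if j == i then psi a else 1.
have [P key] : exists P, forall psi : A -> R,
    \sum_(w : Om) psi (w i) = (\sum_a psi a) * P.
  exists (\prod_(j | j != i) \sum_(a : A) 1) => psi; transitivity (\prod_j \sum_a F psi j a).
    rewrite bigA_distr_bigA; apply: eq_bigr => w _.
    rewrite (bigD1 i) //= /F eqxx big1 ?mulr1 // => j /negPf -> //.
  rewrite (bigD1 i) //=; congr (_ * _); first by apply: eq_bigr => a _; rewrite /F eqxx.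
  by apply: eq_bigr => j /negPf ji; apply: eq_bigr => a _; rewrite /F ji.
have key1 := key (fun=> 1); rewrite !sumr_const !cardT -!cardE in key1.
have := Om_neq0; rewrite {1}key1 mulf_eq0 => /norP[A_neq0 P_neq0].
by rewrite /mean key key1 -mulf_div divff ?mulr1.
Qed.
End ProductSpace.

(** * Random walks down a chain *)

(** At the least scale where [x] and [z] share a dyadic cell, they lie in different halves of it;
    [s] is one scale finer. *)
Lemma adjacent_cells (h x z : nat) : (x < z)%N -> (z < 2 ^ h)%N ->
  exists s : 'I_h, (z %/ 2 ^ s = (x %/ 2 ^ s).+1)%N.
Proof.
move=> xz zh.
have ex : exists s, (x %/ 2 ^ s == z %/ 2 ^ s)%N.
  by exists h; rewrite !divn_small // (ltn_trans xz).
case: (ex_minnP ex) => -[|s] /eqP eq_s s_min; first by rewrite !divn1 in eq_s; lia.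
have sh : (s < h)%N.
  by apply: s_min; rewrite !divn_small // (ltn_trans xz).
exists (Ordinal sh) => /=.
have neq : (x %/ 2 ^ s != z %/ 2 ^ s)%N by apply: contraL (ltnSn s) => /s_min; rewrite leqNgt.
have le : (x %/ 2 ^ s <= z %/ 2 ^ s)%N by rewrite leq_div2r // ltnW.
move: eq_s; rewrite !expnSr !divnMA; lia.
Qed.

Lemma card_le_sum_cover (T J : finType) (A : {set T}) (B : J -> {set T}) :
  (forall t, t \in A -> exists j, t \in B j) -> (#|A| <= \sum_j #|B j|)%N.
Proof.
move=> cover; under [X in (_ <= X)%N]eq_bigr do rewrite -sum1_card big_mkcond.
rewrite -sum1_card big_mkcond exchange_big /=; apply: leq_sum => t _.
case: ifP => // /cover[j jB]; rewrite (bigD1 j) //= jB; exact: leq_addr.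
Qed.

Section Chains.
Variables (R : realType) (n' h : nat).
Notation n := n'.+1.
Hypotheses (h_gt0 : (0 < h)%N) (nh : (n <= 2 ^ h)%N).
Variable f : 'I_n -> R.
Notation local := ('I_h * 'I_(2 ^ h))%type.
Implicit Types (z y : 'I_n) (u : R) (l : local).

(* With s uniform in [0, h) and j uniform in [0, 2^h), this is a uniform point
   of the cell of width 2^s preceding the one of z. If there is none, the
   result is irrelevant. *)
Definition step z l : 'I_n :=
  inord (2 ^ l.1 * (z %/ 2 ^ l.1).-1 + l.2 %% 2 ^ l.1).

Fixpoint walk z (ls : seq local) : seq 'I_n :=
  if ls is l :: ls' then step z l :: walk (step z l) ls' else [::].

Fixpoint good_walk z u (ls : seq local) : bool :=
  if ls is l :: ls'
  then [&& (step z l < z)%N, f (step z l) < u & good_walk (step z l) (f (step z l)) ls']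
  else true.

Definition walk_prob m z u : R :=
  mean (fun ls : m.-tuple local => (good_walk z u ls)%:R).

Definition local0 : local := (Ordinal h_gt0, Ordinal (expn_gt0 2 h : (0 < 2 ^ h)%N)).

Lemma walk_prob0 z u : walk_prob 0 z u = 1.
Proof.
rewrite /walk_prob -[RHS](@mean_cst R _ ([tuple] : 0.-tuple local)).
by congr (mean _); apply/funext => ls; rewrite tuple0.
Qed.

Lemma walk_probS m z u : walk_prob m.+1 z u =
  mean (fun l : local => ((step z l < z)%N && (f (step z l) < u))%:R *
    walk_prob m (step z l) (f (step z l))).
Proof.
rewrite /walk_prob {1 2}/mean card_tuple expnS natrM invfM mulrCA mulrC.
rewrite (reindex (fun p : local * m.-tuple local => [tuple of p.1 :: p.2])) /=; last first.
  exists (fun ls : m.+1.-tuple local => (thead ls, [tuple of behead ls])).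
    by move=> [l ls] _ /=; congr (_, _); apply: val_inj.
  by move=> ls _; rewrite -tuple_eta.
rewrite -(pair_big xpredT xpredT (fun (l : local) (ls : m.-tuple local) =>
   (good_walk z u (l :: ls))%:R : R)) /= -mulrA.
rewrite mulr_suml [RHS]mulr_suml; apply: eq_bigr => l _.
rewrite mulrA; congr (_ / _); rewrite /mean card_tuple mulrA; congr (_ / _).
by rewrite mulr_sumr; apply: eq_bigr => ls _; rewrite -natrM mulnb andbA.
Qed.

(** Scale [s] is drawn with probability [1 / h], and then each of the [2 ^ s] points of the
    preceding cell is equally likely. The set [B] supplies [#|B|] of these points, each worth at
    least [gam]. *)
Lemma adjacent_cell_mass (T : finType) (B : {set T}) (x : T -> 'I_n) (z : 'I_n)
    (s : 'I_h) (c : local -> R) (gam : R) :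
    {in B &, injective x} -> (forall l, 0 <= c l) ->
    {in B, forall t, z %/ 2 ^ s = (x t %/ 2 ^ s).+1}%N ->
    (forall l t, t \in B -> step z l = x t -> gam <= c l) ->
  #|B|%:R / (2 ^ s)%:R * gam <= h%:R * mean c.
Proof.
move=> x_inj c_ge0 adj c_ge.
have two_s : (2 ^ h = 2 ^ (h - s) * 2 ^ s)%N by rewrite -expnD subnK // ltnW.
(* Each target [x t] is reached from [2 ^ (h - s)] choices, namely the residue of [x t] plus the
   multiples of [2 ^ s]. *)
have jump_lt (p : T * 'I_(2 ^ (h - s))) : (p.2 * 2 ^ s + x p.1 %% 2 ^ s < 2 ^ h)%N.
  case: p => t [i i_lt] /=; have := ltn_pmod (x t) (expn_gt0 2 s).
  rewrite two_s => lt_mod; apply: (@leq_trans (i.+1 * 2 ^ s)); last by rewrite leq_mul2r i_lt orbT.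
  by rewrite mulSn addnC ltn_add2r.
pose jump p : local := (s, Ordinal (jump_lt p)).
have jump_step t i : t \in B -> step z (jump (t, i)) = x t.
  move=> tB; rewrite /step /= (adj t tB) /=; apply: val_inj; rewrite /= inordK.
    by rewrite modnMDl modn_mod mulnC -divn_eq.
  by rewrite modnMDl modn_mod mulnC -divn_eq.
have jump_inj : {in setX B setT &, injective jump}.
  case=> [t i] [t' i']; rewrite !inE !andbT => tB t'B eq_j.
  have eq_t : t = t'.
    apply: x_inj => //; rewrite -(jump_step t i) // -(jump_step t' i') //.
    by rewrite eq_j.
  move: eq_j; rewrite eq_t /jump => -[]; set e := (_ %% _)%N => eq_i.
  congr (_, _); apply: val_inj => /=.
  have : (i * 2 ^ s = i' * 2 ^ s)%N by lia.
  by move/eqP; rewrite eqn_pmul2r ?expn_gt0 // => /eqP.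
have sum_ge : #|B|%:R * (2 ^ (h - s))%:R * gam <= \sum_l c l.
  apply: (@le_trans _ _ (\sum_(l in jump @: setX B setT) c l)).
    rewrite -natrM -[X in (_ * X)%N](card_ord (2 ^ (h - s))) -cardsT -cardsX.
    rewrite -(card_in_imset jump_inj) mulr_natl -sumr_const; apply: ler_sum => l.
    case/imsetP=> p + ->; case: p => t i; rewrite in_setX in_setT andbT => tB.
    exact: (c_ge _ t tB (jump_step t i tB)).
  by rewrite [leRHS](bigID (mem (jump @: setX B setT))) /= lerDl sumr_ge0.
rewrite /mean card_prod !card_ord natrM.
have h0 : h%:R != 0 :> R by rewrite pnatr_eq0 -lt0n.
have e0 m : (2 ^ m)%:R != 0 :> R by rewrite pnatr_eq0 -lt0n expn_gt0.
rewrite invfM mulrCA [h%:R * _]mulrA divff // mul1r.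
have -> : #|B|%:R / (2 ^ s)%:R * gam = #|B|%:R * (2 ^ (h - s))%:R * gam / (2 ^ h)%:R.
  by rewrite two_s natrM; field; rewrite !e0.
by rewrite ler_wpM2r ?invr_ge0.
Qed.

(* Among the bad starts with the same pair of adjacent cells, the one with the
   largest bound u may step to x t for every other bad start t of the pair, so
   there cannot be many of them. *)
Lemma few_bad_starts (T : finType) (G : {set T}) (x z : T -> 'I_n) (u : T -> R)
    (g : 'I_n -> R) (gam beta : R) :
    0 < gam -> 0 <= beta -> (forall y, 0 <= g y) ->
    {in G &, injective x} ->
    {in G, forall t, [/\ (x t < z t)%N, f (x t) < u t & gam <= g (x t)]} ->
  #|[set t in G | mean (fun l => ((step (z t) l < z t)%N && (f (step (z t) l) < u t))%:R
                     * g (step (z t) l)) < beta / h%:R * gam]|%:R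
    <= h%:R * (beta * n%:R).
Proof.
move=> gam_gt0 beta_ge0 g_ge0 x_inj GP; set bad := [set t in G | _].
have h0 : 0 < h%:R :> R by rewrite ltr0n.
pose B (s : 'I_h) (w : nat) : {set T} :=
  [set t in bad | (x t %/ 2 ^ s == w) && (z t %/ 2 ^ s == w.+1)]%N.
have B_small s w : #|B s w|%:R <= beta * (2 ^ s)%:R.
  have [->|[t1 t1B]] := set_0Vmem (B s w); first by rewrite cards0 mulr_ge0.
  have [t0 t0B t0max] := arg_maxP u t1B.
  have {}t0B : t0 \in B s w by exact: t0B.
  have : t0 \in bad by move: t0B; rewrite inE => /andP[].
  rewrite inE => /andP[t0G]; set c := (fun l => _) => c_lt.
  have BG t : t \in B s w -> t \in G by rewrite inE => /andP[+ _]; rewrite inE => /andP[].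
  have Bcell t : t \in B s w -> (x t %/ 2 ^ s = w /\ z t %/ 2 ^ s = w.+1)%N.
    by rewrite inE => /and3P[_ /eqP -> /eqP ->].
  have mass : #|B s w|%:R / (2 ^ s)%:R * gam <= h%:R * mean c.
    apply: (@adjacent_cell_mass _ _ x (z t0)) => [t t' /BG tG /BG t'G|l|t tB|l t tB eq_l].
  - exact: x_inj.
  - by rewrite /c mulr_ge0.
  - by have [-> _] := Bcell t tB; have [_ ->] := Bcell t0 t0B.
  - have [_ fx gx] := GP t (BG t tB); rewrite /c eq_l.
    have ut : u t <= u t0 by apply: t0max.
    rewrite (lt_le_trans fx ut) andbT (_ : (x t < z t0)%N) ?mul1r //.
    rewrite ltnNge; apply/negP => /(leq_div2r (2 ^ s)).
    by have [-> _] := Bcell t tB; have [_ ->] := Bcell t0 t0B; rewrite ltnn.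
  have : h%:R * mean c < beta * gam.
    have : h%:R * mean c < h%:R * (beta / h%:R * gam) by rewrite ltr_pM2l.
    by rewrite [beta / _]mulrC -mulrA mulVKf ?gt_eqF.
  move/(le_lt_trans mass); rewrite ltr_pM2r // ltr_pdivrMr ?ltr0n ?expn_gt0 //.
  exact: ltW.
have cover t : t \in bad -> exists s : 'I_h, t \in \bigcup_(w < n %/ 2 ^ s) B s w.
  move=> tbad; have /andP[tG _] : (t \in G) && true by move: tbad; rewrite inE => /andP[->].
  have [xz _ _] := GP t tG.
  have [s zs] := adjacent_cells xz (leq_trans (ltn_ord (z t)) nh).
  exists s; apply/bigcupP.
  (* The next cell contains [z t], so the cell of [x t] lies wholly inside the domain. Thus
     [n %/ 2 ^ s] cells suffice, of total width at most [n]. *)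
  have wlt : (x t %/ 2 ^ s < n %/ 2 ^ s)%N by rewrite -zs leq_div2r // ltnW.
  by exists (Ordinal wlt) => //; rewrite inE tbad eqxx zs /=.
have := card_le_sum_cover cover; rewrite -(ler_nat R) => /le_trans; apply.
rewrite natr_sum -[X in X%:R * _](card_ord h) mulr_natl -sumr_const.
apply: ler_sum => s _.
have : (#|\bigcup_(w < n %/ 2 ^ s) B s w| <= \sum_(w < n %/ 2 ^ s) #|B s w|)%N.
  by apply: card_le_sum_cover => t /bigcupP[w _ tw]; exists w.
rewrite -(ler_nat R) => /le_trans; apply.
apply: (@le_trans _ _ (\sum_(w < n %/ 2 ^ s) beta * (2 ^ s)%:R)).
  by rewrite natr_sum ler_sum.
rewrite sumr_const card_ord -mulrnAr ler_wpM2l // -mulrnA ler_nat.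
by rewrite mulnC leq_divM.
Qed.

(** Induction along the chain: a start at level [m + 1] is bad only if the one at level [m] is bad,
    or if it rarely steps to good points of level [m]. Each level adds at most [h * beta * n] bad
    elements. *)
Lemma few_bad_walks (T : finType) (M : {set T}) (r : nat) (X : nat -> T -> 'I_n)
    (U : nat -> T -> R) (beta : R) : 0 < beta ->
    {in M, forall t m, (m < r)%N -> [/\ (X m t < X m.+1 t)%N,
       f (X m t) < U m.+1 t & U m t = f (X m t)]} ->
    (forall m, (m < r)%N -> {in M &, injective (X m)}) ->
  forall m, (m <= r)%N ->
  #|[set t in M | walk_prob m (X m t) (U m t) < (beta / h%:R) ^+ m]|%:R
    <= m%:R * (h%:R * (beta * n%:R)).
Proof.
move=> beta_gt0 XU X_inj; elim=> [_|m IH mr].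
  rewrite mul0r (_ : [set _ in _ | _] = set0) ?cards0 //.
  by apply/setP => t; rewrite !inE walk_prob0 ltxx andbF.
have h0 : 0 < h%:R :> R by rewrite ltr0n.
set q := beta / h%:R in IH *.
have q_gt0 : 0 < q by rewrite divr_gt0.
pose G := [set t in M | q ^+ m <= walk_prob m (X m t) (f (X m t))].
have walk_ge0 m' z u : 0 <= walk_prob m' z u.
  by rewrite /walk_prob /mean divr_ge0 // sumr_ge0.
have new_bad : #|[set t in G | walk_prob m.+1 (X m.+1 t) (U m.+1 t) < q * q ^+ m]|%:R
    <= h%:R * (beta * n%:R).
  under eq_finset do rewrite walk_probS.
  apply: (@few_bad_starts _ _ (X m) _ _ (fun y => walk_prob m y (f y))) => [||y|t t'|t] //.
  - exact: exprn_gt0.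
  - exact: ltW.
  - by rewrite !inE => /andP[tM _] /andP[t'M _]; apply: X_inj.
  - by rewrite inE => /andP[tM gt]; have [] := XU t tM m mr.
rewrite -[m.+1]addn1 natrD mulrDl mul1r addn1.
apply: le_trans (lerD (IH (ltnW mr)) new_bad); rewrite -natrD ler_nat.
apply: leq_trans (leq_card_setU _ _); apply/subset_leq_card/subsetP => t.
rewrite !inE exprS => /andP[tM lt_t]; rewrite tM lt_t /= andbT.
by have [_ _ ->] := XU t tM m mr; case: ltP.
Qed.
End Chains.

(** * The sampling test *)

(* The 0-based pattern 0, 1, ..., r-1, k-1, k-2, ..., r. *)
Definition hook_val (k r i : nat) : nat := (if i < r then i else k.-1 + r - i)%N.

Definition is_hook (k r : nat) (pi : 'S_k) : Prop :=
  forall i : 'I_k, (pi i : nat) = hook_val k r i.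

Lemma hook_exists (k r : nat) : (r <= k)%N -> exists pi : 'S_k, is_hook r pi.
Proof.
move=> rk; have lt (i : 'I_k) : (hook_val k r i < k)%N.
  by case: i => i ik; rewrite /hook_val /=; case: ifP; lia.
have inj : injective (fun i => Ordinal (lt i)).
  case=> [i ik] [j jk] [] e; apply: val_inj => /=; move: e.
  by rewrite /hook_val /=; do 2!case: ifP; lia.
by exists (perm inj) => i; rewrite permE.
Qed.

(** The step from value [r - 1] to value [k - 1] has length [k - r]; all other steps have length
    1. *)
Lemma max_jump_hook (k r : nat) (pi : 'S_k) : (0 < r < k)%N -> is_hook r pi ->
  max_jump pi = (k - r)%N.
Proof.
move=> /andP[r_gt0 rk] piE; apply/eqP; rewrite eqn_leq; apply/andP; split.
  apply/bigmax_leqP => i _; apply/bigmax_leqP => j /eqP ji.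
  rewrite !piE ji /hook_val; have := ltn_ord j; rewrite ji.
  by do 2!case: ifP; lia.
have i_lt : (r.-1 < k)%N by lia.
rewrite /max_jump (bigD1 (Ordinal i_lt)) //= leq_max; apply/orP; left.
rewrite (bigD1 (Ordinal rk)) /=; last by rewrite prednK.
rewrite leq_max; apply/orP; left; rewrite !piE /hook_val /=.
by rewrite ltnn ifT; lia.
Qed.

(** Induction on [(1 - p) * (1 + (m + 1) * p) <= 1 + m * p]; it stands in for an exponential
    estimate. *)
Lemma prod_one_sub_le (R : realType) (p : R) (m : nat) : 0 <= p <= 1 ->
  (1 - p) ^+ m <= 1 / (1 + m%:R * p).
Proof.
case/andP=> p_ge0 p_le1.
have pos j : 0 < 1 + j%:R * p by rewrite ltr_wpDr // mulr_ge0.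
rewrite ler_pdivlMr //; elim: m => [|m IH]; first by rewrite expr0 mul0r addr0 mulr1.
apply: le_trans IH; rewrite exprSr -mulrA ler_wpM2l ?exprn_ge0 ?subr_ge0 //.
have := mulr_ge0 (ler0n R m) (mulr_ge0 p_ge0 p_ge0); rewrite -natr1; nra.
Qed.

Lemma mean_pair (R : realType) (A B : finType) (phi : A -> R) (psi : B -> R) :
  mean (fun p : A * B => phi p.1 * psi p.2) = mean phi * mean psi.
Proof.
rewrite /mean -(pair_big xpredT xpredT (fun a b => phi a * psi b)) /=.
rewrite card_prod natrM mulrACA -invfM; congr (_ / _).
by rewrite mulr_suml; apply: eq_bigr => a _; rewrite mulr_sumr.
Qed.

Lemma mean_eq_ord0 (R : realType) (m : nat) :
  mean (fun c : 'I_m.+1 => (c == ord0)%:R : R) = m.+1%:R^-1.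
Proof.
rewrite mean_indicator card_ord (_ : [set w | w == ord0] = [set ord0]).
  by rewrite cards1 mul1r.
by apply/setP => w; rewrite !inE.
Qed.

Section Sampler.
Variables (R : realType) (k r n' h K' : nat) (pi : 'S_k).
Notation n := n'.+1.
Notation K := K'.+1.
Hypotheses (r_gt0 : (0 < r)%N) (rk : (r < k)%N) (pi_hook : is_hook r pi).
Hypotheses (h_gt0 : (0 < h)%N) (nh : (n <= 2 ^ h)%N).
Notation local := ('I_h * 'I_(2 ^ h))%type.
Notation color := ('I_K * r.-tuple local)%type.
Notation Om := {ffun 'I_n -> color}.

Let color0 : color := (ord0, [tuple of nseq r (local0 h_gt0)]).
Let om0 : Om := [ffun=> color0].

(** One of [K] equally likely values is singled out, so a position is active with probability
    [1 / K]. *)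
Definition active (w : Om) : {set 'I_n} := [set x | (w x).1 == ord0].

(* By Markov's inequality this costs only a probability 1/6, and it makes the
   number of queries bounded in the worst case. *)
Definition overfull (w : Om) : bool := (6 * n < #|active w| * K)%N.

Definition sample (w : Om) : {set 'I_n} :=
  if overfull w then set0 else
  \bigcup_(x in active w) [set y in x :: walk x (w x).2].

Lemma size_walk (z : 'I_n) (ls : seq local) : size (walk z ls) = size ls.
Proof. by elim: ls z => //= l ls IH z; rewrite IH. Qed.

Lemma card_sample w : (#|sample w| <= 6 * n * r.+1 %/ K)%N.
Proof.
rewrite /sample; case: ifP => [_|/negbT]; first by rewrite cards0.
rewrite /overfull -leqNgt leq_divRL // => few.
apply: (@leq_trans (#|active w| * K * r.+1)); last by rewrite leq_mul2r few orbT.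
rewrite mulnAC leq_mul2r /=; apply: leq_trans (_ : \sum_(x in active w) r.+1 <= _)%N; last first.
  by rewrite sum_nat_const.
apply: (@leq_trans (\sum_(x in active w) #|[set y in x :: walk x (w x).2]|)).
  elim/big_rec2: _ => [|x m A _ IH]; first by rewrite cards0.
  by rewrite (leq_trans (leq_card_setU _ _)) // leq_add2l.
apply: leq_sum => x _; rewrite cardsE (leq_trans (card_size _)) //=.
by rewrite size_walk size_tuple.
Qed.

Lemma mean_overfull : mean (fun w => (overfull w)%:R : R) <= 1 / 6.
Proof.
have mean_active : mean (fun w : Om => #|active w|%:R : R) = n%:R / K%:R.
  under eq_fun => w do rewrite -sum1_card natr_sum big_mkcond /=.
  rewrite mean_sum; transitivity (\sum_(x : 'I_n) (K%:R^-1 : R)); last first.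
    by rewrite sumr_const card_ord mulr_natl.
  apply: eq_bigr => x _; rewrite -mean_eq_ord0.
  pose phi (c : color) : R := (c.1 == ord0)%:R * 1.
  transitivity (mean (fun w : Om => phi (w x))).
    by congr (mean _); apply/funext => w; rewrite inE /phi mulr1; case: eqP.
  rewrite (mean_coord color0) [LHS](mean_pair (fun c => (c == ord0)%:R) (fun=> 1)).
  by rewrite (mean_cst color0.2) mulr1.
have := @le_mean R _ (fun w => (6 * n)%:R * (overfull w)%:R)
  (fun w => K%:R * #|active w|%:R).
rewrite !meanZ mean_active => le; have {le} : (6 * n)%:R * mean (fun w => (overfull w)%:R) <= n%:R :> R.
  rewrite (_ : n%:R = K%:R * (n%:R / K%:R)); last by rewrite mulrCA divff ?mulr1 // pnatr_eq0.
  apply: le => w; rewrite -!natrM ler_nat /overfull; case: ltnP => [/ltnW|_].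
    by rewrite muln1 mulnC [(_ * #|_|)%N]mulnC.
  by rewrite muln0.
rewrite natrM mulrAC -[leRHS]mul1r ler_pM2r ?ltr0n //; lra.
Qed.

(** * Success probability of the sampler on a far input *)

Section FarInput.
Variables (f : 'I_n -> R) (M : {set {ffun 'I_k -> 'I_n}}).
Hypothesis M_copy : forall t, t \in M -> is_copy pi f t.
Hypothesis M_disj :
  forall t t' (a a' : 'I_k), t \in M -> t' \in M -> t a = t' a' -> t = t'.
Implicit Type t : {ffun 'I_k -> 'I_n}.

Let k_gt0 : (0 < k)%N := leq_ltn_trans (leq0n r) rk.
Definition role (m : nat) : 'I_k := insubd (Ordinal k_gt0) m.

Lemma val_role m : (m < k)%N -> role m = m :> nat.
Proof. by move=> mk; rewrite val_insubd mk. Qed.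

(** The value that a walk started at role [m] must stay below. For [m = r] it is the value of role
    [k - 1], the lowest among roles [r, ..., k - 1]. *)
Definition ceiling m t : R := if (m < r)%N then f (t (role m)) else f (t (role k.-1)).

Lemma ceiling_gt t m : t \in M -> (m < r)%N -> f (t (role m)) < ceiling m.+1 t.
Proof.
move=> tM mr; have [_ ord] := M_copy tM; rewrite /ceiling.
case: ifP => mr'; apply/ord; rewrite !pi_hook /hook_val !val_role; try lia.
all: by rewrite ?mr ?mr' //; do ?case: ifP; lia.
Qed.

Lemma few_bad_copies beta : 0 < beta ->
  #|[set t in M | walk_prob h f r (t (role r)) (ceiling r t) < (beta / h%:R) ^+ r]|%:R
    <= r%:R * (h%:R * (beta * n%:R)).
Proof.
move=> beta_gt0.
apply: (@few_bad_walks R n' h h_gt0 nh f _ M r (fun m t => t (role m)) ceiling) => //.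
  move=> t tM m mr; split; [|exact: ceiling_gt|by rewrite /ceiling mr].
  by have [inc _] := M_copy tM; apply: inc; rewrite !val_role; lia.
by move=> m mr t t' tM t'M /M_disj; apply.
Qed.

Lemma good_walkP z u (ls : seq local) : good_walk f z u ls ->
  sorted (fun a b : 'I_n => (b < a)%N && (f b < f a)) (walk z ls) /\
  all (fun y : 'I_n => (y < z)%N && (f y < u)) (walk z ls).
Proof.
elim: ls z u => //= l ls IH z u /and3P[lt_z lt_u /IH[srt below]].
rewrite lt_z lt_u /= path_min_sorted // srt; split=> //.
apply: sub_all below => y /andP[lt_y lt_fy].
by rewrite (ltn_trans lt_y) // (lt_trans lt_fy).
Qed.

(* Roles r, ..., k-1 are all taken from the same copy t; only the roles below r
   are found by the walk, possibly in other copies. *)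
Definition found t (w : Om) : bool :=
  [forall a : 'I_k, (r <= a)%N ==> (t a \in active w)] &&
  good_walk f (t (role r)) (ceiling r t) (w (t (role r))).2.

Lemma found_copy_in t w : t \in M -> found t w -> ~~ overfull w ->
  copy_in pi f (sample w).
Proof.
move=> tM /andP[/forallP act good] small; have [inc ord] := M_copy tM.
have{}act (a : 'I_k) : (r <= a)%N -> t a \in active w by move=> ra; have := act a; rewrite ra.
have [] := good_walkP good; set z := t _; set s := walk _ _ => srt /allP below.
have sz : size s = r by rewrite size_walk size_tuple.
have s_lt i j : (i < j)%N -> (j < r)%N ->
    (nth z s j < nth z s i)%N && (f (nth z s j) < f (nth z s i)).
  move=> ij jr; apply: (sorted_ltn_nth _ _ srt) => //; rewrite ?inE ?sz //.
    move=> y x y' /andP[h1 h2] /andP[h3 h4].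
    by rewrite (ltn_trans h3 h1) (lt_trans h4 h2).
  exact: ltn_trans jr.
have s_in i : (i < r)%N -> nth z s i \in s by move=> ir; rewrite mem_nth ?sz.
have role_r : role r = r :> nat by rewrite val_role.
(* The walk runs leftwards, so its last point plays role 0. *)
pose c (a : 'I_k) := if (a < r)%N then nth z s (r.-1 - a) else t a.
exists c.
  apply: is_copyP => a b.
    move=> ab; rewrite /c; case: ifP => ar; case: ifP => br; try lia.
    - by have /andP[] := @s_lt (r.-1 - b)%N (r.-1 - a)%N ltac:(lia) ltac:(lia).
    - have /below/andP[lt_z _] := s_in (r.-1 - a)%N ltac:(lia).
      apply: leq_trans lt_z _; have [->|/eqP br'] := eqVneq b (role r); first by [].
      apply/ltnW/inc; rewrite role_r; have : (b : nat) <> r; last by lia.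
      by move=> e; apply: br'; apply: val_inj; rewrite /= role_r.
    - exact: inc.
  have := ltn_ord a; have := ltn_ord b => bk ak pab; rewrite /c.
  case: ifP => ar; case: ifP => br.
  - move: pab; rewrite !pi_hook /hook_val ar br => ab.
    by have /andP[] := @s_lt (r.-1 - b)%N (r.-1 - a)%N ltac:(lia) ltac:(lia).
  - have /below/andP[_ lt_u] := s_in (r.-1 - a)%N ltac:(lia).
    apply: lt_le_trans lt_u _; rewrite /ceiling ltnn.
    have [->|/eqP br'] := eqVneq b (role k.-1); first by [].
    apply/ltW/ord; rewrite !pi_hook /hook_val val_role ?ltnn; last by lia.
    have : (b : nat) <> k.-1.
      by move=> e; apply: br'; apply: val_inj; rewrite /= val_role //; lia.
    by rewrite br; case: ifP; lia.
  - by move: pab; rewrite !pi_hook /hook_val ar br; lia.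
  - exact/ord.
move=> a; rewrite /sample (negPf small); apply/bigcupP; rewrite /c; case: ifP => ar.
  exists z; first by apply: act; rewrite role_r.
  by rewrite inE in_cons s_in ?orbT //; lia.
by exists (t a); [apply: act; rewrite leqNgt ar|rewrite inE in_cons eqxx].
Qed.

(** Writes [found] as a product of factors that each depend on the colour of a single position, so
    that independence applies. *)
Definition foundR t (w : Om) : R :=
  \prod_(a <- [seq a : 'I_k <- enum 'I_k | (r <= a)%N])
     (((w (t a)).1 == ord0)%:R *
      (if a == role r then good_walk f (t a) (ceiling r t) (w (t a)).2 else true)%:R).

Lemma foundRE t w : foundR t w = (found t w)%:R.
Proof.
have role_r : role r = r :> nat by rewrite val_role.
rewrite /foundR; have [/andP[/forallP act good]|] := boolP (found t w).
  rewrite big1_seq // => a; rewrite mem_filter => /andP[_ /andP[ra _]].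
  have := act a; rewrite ra inE /= => ->; rewrite mul1r.
  by case: eqP => // ->; rewrite good.
rewrite negb_and negb_forall => /orP[/existsP[a]|bad].
  rewrite negb_imply inE => /andP[ra /negPf bad]; apply/eqP.
  rewrite prodf_seq_eq0; apply/hasP; exists a; first by rewrite mem_filter ra mem_enum.
  by rewrite /= bad mul0r.
apply/eqP; rewrite prodf_seq_eq0; apply/hasP; exists (role r).
  by rewrite mem_filter role_r leqnn mem_enum.
by rewrite /= eqxx (negPf bad) mulr0.
Qed.

Lemma mean_foundR t : t \in M ->
  mean (foundR t) = K%:R^-1 ^+ (k - r) * walk_prob h f r (t (role r)) (ceiling r t).
Proof.
move=> tM; have role_r : role r = r :> nat by rewrite val_role.
pose phi a (c : color) : R := (c.1 == ord0)%:R *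
  (if a == role r then good_walk f (t a) (ceiling r t) c.2 else true)%:R.
rewrite /foundR (mean_prod_disjoint color0 (S := fun a => [set t a])
  (X := fun a w => phi a (w (t a)))); first last.
- move=> a b _ _ ab; rewrite disjoints1 inE.
  by apply: contra ab => /eqP/(copy_inj (M_copy tM)) ->.
- by move=> a _ w w' eq_w; rewrite eq_w ?inE.
- by rewrite filter_uniq // enum_uniq.
have mean_phi a : mean (phi a) = K%:R^-1 *
    (if a == role r then walk_prob h f r (t a) (ceiling r t) else 1).
  rewrite [LHS](mean_pair (fun c => (c == ord0)%:R) (fun ls : r.-tuple local =>
    (if a == role r then good_walk f (t a) (ceiling r t) ls else true)%:R)).
  rewrite mean_eq_ord0; congr (_ * _); case: eqP => // _.
  exact: (mean_cst color0.2).
under eq_bigr do rewrite (mean_coord color0) mean_phi.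
rewrite big_split /= big_filter big_enum_cond /=; congr (_ * _).
  rewrite prodr_const; congr (_ ^+ _).
  by rewrite -sum1_card -(big_geq_mkord r k xpredT (fun=> 1%N)) sum_nat_const_nat muln1.
rewrite big_filter big_enum_cond /= (bigD1 (role r)) ?role_r //= eqxx big1 ?mulr1 //.
by move=> a /andP[_ /negPf ->].
Qed.

(** Disjoint copies are found independently, so all are missed with probability at most
    [1 / (1 + 5)]. Overfull samples cost another [1 / 6], which leaves [2 / 3]. *)
Lemma sample_success (G : {set {ffun 'I_k -> 'I_n}}) (p : R) : G \subset M ->
    0 <= p -> {in G, forall t, p <= mean (foundR t)} -> 5 <= #|G|%:R * p ->
  2 / 3 * #|{: Om}|%:R <= #|[set w | `[< copy_in pi f (sample w) >]]|%:R :> R.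
Proof.
move=> /subsetP GM p_ge0 p_le G_big.
have foundR01 t w : 0 <= foundR t w <= 1 by rewrite foundRE; case: found; rewrite ?ler01 ?lexx.
have mean_found_le1 t : mean (foundR t) <= 1.
  by rewrite -[leRHS](mean_cst om0); apply: le_mean => w; case/andP: (foundR01 t w).
pose none w := \prod_(t <- enum G) (1 - foundR t w).
have mean_none : mean none <= 1 / 6.
  have -> : mean none = \prod_(t <- enum G) (1 - mean (foundR t)).
    rewrite /none (mean_prod_disjoint color0 (S := fun t => [set t a | a : 'I_k])
      (X := fun t w => 1 - foundR t w)) ?enum_uniq //.
    - apply: eq_bigr => t _; rewrite -[1 in RHS](mean_cst om0) -mulN1r -meanZ -meanD.
      by congr (mean _); apply/funext => w; rewrite mulN1r.
    - move=> t _ w w' eq_w; congr (1 - _); apply: eq_bigr => a _.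
      by rewrite eq_w //; apply: imset_f.
    - move=> t t'; rewrite !mem_enum => /GM tM /GM t'M; apply: contraR.
      case/pred0Pn => x /= /andP[/imsetP[a _ ->] /imsetP[a' _ eq_t]].
      exact/eqP/(M_disj tM t'M eq_t).
  have [t0 t0G] : exists t0, t0 \in G.
    apply/set0Pn; apply: contraTneq G_big => ->; rewrite cards0 mul0r; lra.
  have p_le1 : p <= 1 := le_trans (p_le t0 t0G) (mean_found_le1 t0).
  apply: (@le_trans _ _ ((1 - p) ^+ #|G|)).
    rewrite big_enum /= -prodr_const; apply: ler_prod => t tG.
    by rewrite subr_ge0 mean_found_le1 lerB // p_le.
  apply: le_trans (prod_one_sub_le _ _) _; first by rewrite p_ge0.
  by rewrite !div1r lef_pV2 ?posrE; lra.
have Om_gt0 : 0 < #|{: Om}|%:R :> R by rewrite ltr0n; apply/card_gt0P; exists om0.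
rewrite -ler_pdivlMr // -mean_indicator.
(* The union bound, as a pointwise lower bound on the indicator of success. *)
pose lower w : R := 1 + (-1) * ((overfull w)%:R + none w).
apply: (@le_trans _ _ (mean lower)).
  rewrite /lower meanD meanZ meanD (mean_cst om0).
  have := mean_overfull; move: mean_none; lra.
apply: le_mean => w; rewrite /lower.
have none_ge0 : 0 <= none w.
  by apply: prodr_ge0 => t _; rewrite subr_ge0; case/andP: (foundR01 t w).
have [_|small] := boolP (overfull w).
  by apply: (@le_trans _ _ 0); [rewrite mulr1n; lra|exact: ler0n].
case: asboolP => [_|nocopy]; first by rewrite /=; lra.
suff -> : none w = 1 by rewrite /=; lra.
rewrite /none big1_seq // => t; rewrite mem_enum => /andP[_ /GM tM].
rewrite foundRE; case: (boolP (found t w)) => [/(found_copy_in tM)/(_ small)//|_].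
by rewrite subr0.
Qed.

End FarInput.

(** The inequality on [K] says that [eps * n / (2 * k)] copies, each found with probability
    [q ^ r / K ^ (k - r)], give at least 5 in expectation, where [q] is the base of the power on the
    right. *)
Lemma sampled_test (eps : R) : 0 < eps ->
    5 * K%:R ^+ (k - r) <=
      (eps / (2 * k%:R * r%:R * h%:R ^+ 2)) ^+ r * (eps * n%:R / (2 * k%:R)) ->
  exists T : nonadaptive_algorithm R n,
    one_sided_test pi eps T /\ (num_queries T <= 6 * n * r.+1 %/ K)%N.
Proof.
move=> eps_gt0; set q := (eps / _); set half := (_ / (2 * _)) => K_small.
have k_gt1 : (1 < k)%N by exact: leq_ltn_trans rk.
apply: (@test_of_sampler _ _ _ _ _ _ om0 sample); first exact: card_sample.
move=> f far; have [M [Mcopy Mdisj Mbig]] := far_disjoint_copies k_gt1 far.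
have k0 : 0 < k%:R :> R by rewrite ltr0n ltnW.
have r0 : 0 < r%:R :> R by rewrite ltr0n.
have h0 : 0 < h%:R :> R by rewrite ltr0n.
(* With this [beta] there are at most [eps * n / (2 * k)] bad copies, less than half of [M]. *)
pose beta := eps / (2 * k%:R * r%:R * h%:R).
have beta_gt0 : 0 < beta by rewrite divr_gt0 // !mulr_gt0.
have := few_bad_copies Mcopy Mdisj beta_gt0.
have -> : beta / h%:R = q by rewrite /beta /q; field; rewrite !gt_eqF.
have -> : r%:R * (h%:R * (beta * n%:R)) = half.
  by rewrite /beta /half; field; rewrite !gt_eqF.
set bad := [set _ in _ | _] => bad_small.
have badM : bad \subset M by apply/subsetP => t; rewrite inE => /andP[].
have q_gt0 : 0 < q by rewrite divr_gt0 // !mulr_gt0 // exprn_gt0.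
pose p := K%:R^-1 ^+ (k - r) * q ^+ r.
have K0 : 0 < K%:R ^+ (k - r) :> R by rewrite exprn_gt0.
have p_gt0 : 0 < p by rewrite mulr_gt0 ?exprn_gt0 // invr_gt0.
have M_half : 2 * half < #|M|%:R.
  rewrite /half -(ltr_pM2l k0); apply: le_lt_trans Mbig.
  by rewrite le_eqVlt; apply/orP; left; apply/eqP; field; rewrite gt_eqF.
have good_big : half <= #|M :\: bad|%:R.
  by rewrite cardsD (setIidPr badM) natrB ?subset_leq_card //; lra.
apply: (@sample_success f M Mcopy Mdisj (M :\: bad) p) => [||t|].
- exact: subsetDl.
- exact: ltW.
- rewrite !inE => /andP[+ tM]; rewrite tM /= -leNgt => good.
  by rewrite (mean_foundR Mcopy) // ler_wpM2l // exprn_ge0 // invr_ge0.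
apply: (@le_trans _ _ (half * p)); last by rewrite ler_wpM2r // ltW.
by rewrite /p exprVn mulrCA mulrC ler_pdivlMr // [half * _]mulrC.
Qed.

End Sampler.

(** * Hard inputs *)

Lemma far_of_disjoint_copies (R : realType) (k n : nat) (pi : 'S_k) (eps : R)
    (f : 'I_n -> R) (J : finType) (c : J -> 'I_k -> 'I_n) :
    (forall j, is_copy pi f (c j)) ->
    (forall j j' a a', c j a = c j' a' -> j = j') ->
    eps * n%:R < #|J|%:R -> far_from_free pi eps f.
Proof.
move=> copy disj J_big g gfree; apply: lt_le_trans J_big _.
have changed j : exists a, f (c j a) != g (c j a).
  apply: contrapT => same; apply: gfree; exists (c j).
  have eq_fg a : g (c j a) = f (c j a).
    by have [//|ne] := eqVneq (f (c j a)) (g (c j a)); case: same; exists a.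
  by case: (copy j) => inc ord; split=> // a b; rewrite !eq_fg.
have [a aP] := choice changed; rewrite ler_nat.
have inj : injective (fun j => c j (a j)) by move=> j j' /disj.
rewrite -(card_imset predT inj); apply/subset_leq_card/subsetP => x.
by case/imsetP => j _ ->; rewrite inE.
Qed.

Section HardInputs.
Local Open Scope nat_scope.
Variables (r L N : nat).
Notation k := (r + L.+1).
Notation W := (N.*2).
Hypotheses (r_gt0 : 0 < r) (N_gt0 : 0 < N).

(* The domain is cut into blocks of width 2N. The first r-1 blocks are constant;
   the next one is a decreasing sequence of N pairs (low, high); each further
   one is increasing, and shifted by s; all remaining positions get value 0. The
   shifts do not change how many copies there are, only where they are. *)
Definition hard_value (s : nat -> nat) (x : nat) : nat :=
  let b := x %/ W in let i := x %% W in
  if k.-1 <= b then 0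
  else if b < r.-1 then b.+1
  else if b == r.-1 then k + (W.-1 - i./2) * L.+2 + (if odd i then L.+1 else 0)
  else k + (N + i - s (b - r)) * L.+2 + (k.-1 - b).

(** Roles [r - 1] and [r] share the block of pairs, which moves all later roles one block back. *)
Definition hard_block (m : nat) := if m < r then m else m.-1.

Definition hard_offset (s : nat -> nat) (w m : nat) :=
  if m < r.-1 then w
  else if m == r.-1 then w.*2
  else if m == r then w.*2.+1
  else N.-1 - w + s (m.-1 - r).

Definition hard_pos s w m := hard_block m * W + hard_offset s w m.

Lemma div_mod_block b i : i < W -> (b * W + i) %/ W = b /\ (b * W + i) %% W = i.
Proof.
move=> iW; have W_gt0 : 0 < W by rewrite double_gt0.
by rewrite divnMDl // divn_small // addn0 modnMDl modn_small.
Qed.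

Section Shift.
Variable s : nat -> nat.
Hypothesis s_lt : forall j, s j < N.

Lemma hard_offset_lt w m : w < N -> hard_offset s w m < W.
Proof. by move=> wN; rewrite /hard_offset; do 3?case: ifP; have := s_lt (m.-1 - r); lia. Qed.

(** Above the constant blocks, values form bands of width [L + 2]. Copy [w] fills band
    [2 * N - 1 - w], with role [r - 1] at the bottom, role [r] at the top and the later roles in
    between; the shift in the offset cancels the one in the value. *)
Lemma hard_value_pos w m : w < N -> m < k ->
  hard_value s (hard_pos s w m) =
    if m < r.-1 then m.+1 else k + (W.-1 - w) * L.+2 + (if m == r.-1 then 0 else k - m).
Proof.
move=> wN mk; have [div_p mod_p] := div_mod_block (hard_block m) (hard_offset_lt m wN).
rewrite /hard_value /hard_pos div_p mod_p /hard_block /hard_offset.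
have [m_lt|m_ge] := ltnP m r.-1.
  have -> : m < r by lia.
  by rewrite m_lt ifN //; lia.
have [->|m_ne] := eqVneq m r.-1.
  rewrite prednK // leqnn ltnn eqxx odd_double doubleK ifN //; lia.
have [->|m_ne'] := eqVneq m r.
  rewrite !ltnn !eqxx ifN /= ?odd_double ?uphalf_double ?addKn //; lia.
have -> : (m < r) = false by lia.
have -> : (k.-1 <= m.-1) = false by lia.
have -> : (m.-1 < r.-1) = false by lia.
have -> : (m.-1 == r.-1) = false by lia.
have := s_lt (m.-1 - r) => s_m.
by rewrite (_ : N + _ - _ = W.-1 - w); lia.
Qed.

Lemma hard_pos_incr w m m' : w < N -> m < m' -> hard_pos s w m < hard_pos s w m'.
Proof.
move=> wN mm'; rewrite /hard_pos; have := hard_offset_lt m wN.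
have [lt_b|ge_b] := ltnP (hard_block m) (hard_block m').
  move=> lt_o; apply: (@leq_trans ((hard_block m).+1 * W)); first by rewrite mulSn; lia.
  by apply: leq_trans (leq_addr _ _); rewrite leq_mul2r lt_b orbT.
have [-> ->] : m = r.-1 /\ m' = r by move: ge_b; rewrite /hard_block; do 2?case: ifP; lia.
rewrite /hard_block /hard_offset ltnn eqxx ltnn prednK // leqnn.
by do ?case: ifP; lia.
Qed.

Lemma hard_pos_inj w w' m m' : w < N -> w' < N ->
  hard_pos s w m = hard_pos s w' m' -> w = w'.
Proof.
move=> wN w'N eq_p.
have [div_p mod_p] := div_mod_block (hard_block m) (hard_offset_lt m wN).
have [div_p' mod_p'] := div_mod_block (hard_block m') (hard_offset_lt m' w'N).
have eq_b : hard_block m = hard_block m' by rewrite -div_p -div_p'; congr (_ %/ _).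
have : hard_offset s w m = hard_offset s w' m' by rewrite -mod_p -mod_p'; congr (_ %% _).
clear -eq_b r_gt0 wN w'N N_gt0; move: eq_b.
have [<- _|ne eq_b] := eqVneq m m'; first by rewrite /hard_offset; do 3?case: ifP; lia.
have e1 : (r < r.-1) = false by lia.
have e2 : (r == r.-1) = false by lia.
(* Only these two roles share a block, and there the parity of the offset separates them. *)
have [[-> ->]|[-> ->]] : m = r.-1 /\ m' = r \/ m = r /\ m' = r.-1.
- clear -eq_b ne r_gt0; move: eq_b; rewrite /hard_block.
  by have [lt|ge] := ltnP m r; have [lt'|ge'] := ltnP m' r; move/eqP: ne; lia.
- by rewrite /hard_offset ltnn !eqxx e1 e2; lia.
- by rewrite /hard_offset ltnn !eqxx e1 e2; lia.
Qed.

Lemma hard_pos_lt w m : w < N -> m < k -> hard_pos s w m < k.-1 * W.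
Proof.
move=> wN mk; apply: (@leq_trans ((hard_block m).+1 * W)).
  by rewrite /hard_pos mulSn addnC ltn_add2r hard_offset_lt.
by rewrite leq_mul2r; apply/orP; right; rewrite /hard_block; case: ifP; lia.
Qed.

(* The low roles have increasing values, so no two of them share one of the
   first r-1 blocks, which are constant. The high roles have decreasing values,
   so no two of them share one of the last blocks, which are increasing. By
   counting, roles r-1 and r both land in the block of pairs and every other
   block holds one role. An increasing pair in the block of pairs is some
   (2w, 2w+1), and the values lying between its two values force the shifts. *)
Lemma hard_rigid (P : nat -> nat) :
    (forall m m', m < m' -> m' < k -> P m < P m') ->
    (forall m m', m < m' -> m' < r -> hard_value s (P m) < hard_value s (P m')) ->
    (forall m m', r <= m -> m < m' -> m' < k ->
       hard_value s (P m') < hard_value s (P m)) ->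
    (forall m, r <= m -> m < k -> hard_value s (P r.-1) < hard_value s (P m)) ->
  forall j, j < L -> s j = N + P (r.+1 + j) %% W - (W.-1 - (P r %% W)./2).
Proof.
move=> P_incr V_low V_high V_mid j jL.
pose b m := P m %/ W; pose o m := P m %% W.
have PE m : P m = b m * W + o m by apply: divn_eq.
have W_gt0 : 0 < W by rewrite double_gt0.
have o_lt m : o m < W by rewrite ltn_mod.
have VE m : hard_value s (P m) = if k.-1 <= b m then 0 else if b m < r.-1 then (b m).+1
  else if b m == r.-1 then k + (W.-1 - (o m)./2) * L.+2 + (if odd (o m) then L.+1 else 0)
  else k + (N + o m - s (b m - r)) * L.+2 + (k.-1 - b m) by [].
have b_mono m m' : m < m' -> m' < k -> b m <= b m'.
  by move=> mm' m'k; apply: leq_div2r; apply: ltnW; apply: P_incr.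
have o_incr m m' : m < m' -> m' < k -> b m = b m' -> o m < o m'.
  by move=> mm' m'k eq_b; have := P_incr m m' mm' m'k; rewrite !PE eq_b ltn_add2l.
have no_desc m m' : r <= m -> m < m' -> m' < k -> b m = b m' -> r <= b m' -> b m' < k.-1 -> False.
  move=> rm mm' m'k eq_b rb bk; have := V_high m m' rm mm' m'k.
  rewrite !VE eq_b.
  have -> : (k.-1 <= b m') = false by lia.
  have -> : (b m' < r.-1) = false by lia.
  have -> : (b m' == r.-1) = false by lia.
  have := o_incr m m' mm' m'k eq_b; move: (s _) => sv; nia.
(* Positions from block [k - 1] on have value 0, too low for a role above role [r - 1]. *)
have b_last : b k.-1 < k.-1.
  rewrite ltnNge; apply/negP => ge; have := V_mid k.-1 ltac:(lia) ltac:(lia).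
  by rewrite [hard_value s (P k.-1)]VE ge.
have b_lt m : m < k -> b m < k.-1.
  move=> mk; have [->//|ne] := eqVneq m k.-1.
  by apply: leq_ltn_trans b_last; apply: b_mono; lia.
(* Counting from the left, at most one low role per constant block. *)
have b_low m : m < r -> m <= b m.
  elim: m => // m IH mr; rewrite ltnNge; apply/negP => le.
  have le1 := b_mono m m.+1 (ltnSn m) ltac:(lia); have ge1 := IH (ltnW mr).
  have := V_low m m.+1 (ltnSn m) mr; rewrite !VE.
  have -> : (k.-1 <= b m) = false by have := b_lt m ltac:(lia); lia.
  have -> : (k.-1 <= b m.+1) = false by have := b_lt m.+1 ltac:(lia); lia.
  have -> : b m = m by lia.
  have -> : b m.+1 = m by lia.
  by have -> : m < r.-1 by [lia]; rewrite ltnn.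
(* Counting from the right, at most one high role per shifted block. *)
have b_high i : i <= L -> b (k.-1 - i) < k.-1 - i.
  elim: i => [|i IH] iL; first by rewrite subn0.
  have lt1 := IH (ltnW iL); rewrite ltnNge; apply/negP => ge.
  have le1 := b_mono (k.-1 - i.+1) (k.-1 - i) ltac:(lia) ltac:(lia).
  apply: (no_desc (k.-1 - i.+1) (k.-1 - i)); lia.
have b_r1 : b r.-1 = r.-1.
  have := b_low r.-1 ltac:(lia); have := b_high L (leqnn L).
  have := b_mono r.-1 r ltac:(lia) ltac:(lia).
  by rewrite (_ : k.-1 - L = r); lia.
have b_r : b r = r.-1.
  have := b_high L (leqnn L); have := b_mono r.-1 r ltac:(lia) ltac:(lia).
  by rewrite (_ : k.-1 - L = r); lia.
(* Later pairs lie in strictly lower bands, so a larger value further right in this block comes from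
   the same pair. *)
have pair m : r <= m -> m < k -> b m = r.-1 ->
    (o m)./2 = (o r.-1)./2 /\ odd (o m) /\ ~~ odd (o r.-1).
  move=> rm mk bm; have := V_mid m rm mk; rewrite !VE bm b_r1 ltnn eqxx.
  have -> : k.-1 <= r.-1 = false by lia.
  have := o_incr r.-1 m ltac:(lia) mk ltac:(lia).
  have := o_lt m; have := o_lt r.-1.
  have := odd_double_half (o m); have := odd_double_half (o r.-1).
  move: (o m)./2 (o r.-1)./2 => x y.
  move=> e1 e2 lt1 lt2 lt_o lt_V.
  have xy : x = y.
    apply/eqP; rewrite eqn_leq; apply/andP; split; last by lia.
    rewrite leqNgt; apply/negP => yx.
    have : (W.-1 - x).+1 * L.+2 <= (W.-1 - y) * L.+2 by rewrite leq_mul2r; apply/orP; right; lia.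
    by move: lt_V; rewrite mulSn; do 2?case: ifP; lia.
  by split=> //; move: e1 e2; do 2!case: odd; lia.
have [r_half [r_odd r1_even]] := pair r (leqnn r) ltac:(lia) b_r.
have b_up i : i < L -> b (r.+1 + i) = r + i.
  have up : r + i <= b (r.+1 + i) -> i < L -> b (r.+1 + i) = r + i.
    move=> ge iL; apply/eqP; rewrite eqn_leq ge andbT.
    have := b_high (k.-1 - (r.+1 + i)) ltac:(lia).
    by rewrite (_ : k.-1 - (k.-1 - (r.+1 + i)) = r.+1 + i); lia.
  elim: i up => [|i IH] up iL; apply: up => //.
    rewrite !addn0 -(prednK r_gt0) -{1}b_r ltn_neqAle b_mono ?prednK ?andbT //; try lia.
    (* A third role in the block of pairs would coincide with role [r], the high element of the
       pair. *)
    apply/negP => /eqP eq_b; have [m_half [m_odd _]] := pair r.+1 ltac:(lia) ltac:(lia) ltac:(lia).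
    have := o_incr r r.+1 ltac:(lia) ltac:(lia) eq_b.
    have := odd_double_half (o r); have := odd_double_half (o r.+1).
    by rewrite m_half r_half m_odd r_odd; lia.
  have bi : b (r.+1 + i) = r + i.
    apply: IH; last exact: ltnW.
    move=> ge _; apply/eqP; rewrite eqn_leq ge andbT.
    have := b_high (k.-1 - (r.+1 + i)) ltac:(lia).
    by rewrite (_ : k.-1 - (k.-1 - (r.+1 + i)) = r.+1 + i); lia.
  have le1 := b_mono (r.+1 + i) (r.+1 + i.+1) ltac:(lia) ltac:(lia).
  rewrite addnS ltn_neqAle -{2}bi le1 andbT; apply/negP => /eqP eq_b.
  by apply: (no_desc (r.+1 + i) (r.+1 + i.+1)); lia.
(* The value of this role lies strictly between those of roles [r - 1] and [r], the two ends of one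
   band, so it lies in that band; solving for [s j] gives the formula. *)
set m := r.+1 + j; have bm : b m = r + j by exact: b_up.
have := V_high r m (leqnn r) ltac:(lia) ltac:(lia); have := V_mid m ltac:(lia) ltac:(lia).
have Vm : hard_value s (P m) = k + (N + o m - s j) * L.+2 + (L - j).
  rewrite VE bm addKn.
  have -> : (k.-1 <= r + j) = false by lia.
  have -> : (r + j < r.-1) = false by lia.
  have -> : (r + j == r.-1) = false by lia.
  lia.
have V_r : hard_value s (P r) = k + (W.-1 - (o r)./2) * L.+2 + L.+1.
  by rewrite VE b_r ltnn eqxx r_odd ifN //; lia.
have V_r1 : hard_value s (P r.-1) = k + (W.-1 - (o r)./2) * L.+2.
  by rewrite VE b_r1 ltnn eqxx r_half (negPf r1_even) addn0 ifN //; lia.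
rewrite Vm V_r V_r1 -/(o m) -/(o r).
move: (W.-1 - (o r)./2) => t lt1 lt2; have := s_lt j => sj.
suff : N + o m - s j = t by lia.
move: (N + o m - s j) lt1 lt2 => u lt1 lt2.
have [lt_ut|lt_tu|//] := ltngtP u t.
  have : u.+1 * L.+2 <= t * L.+2 by rewrite leq_mul2r lt_ut orbT.
  by rewrite mulSn; lia.
have : t.+1 * L.+2 <= u * L.+2 by rewrite leq_mul2r lt_tu orbT.
by rewrite mulSn; lia.
Qed.

End Shift.
End HardInputs.

(** * Lower bound on the number of queries *)

Section LowerBound.
Variables (R : realType) (n r L N : nat) (pi : 'S_(r + L.+1)) (eps : R).
Notation k := (r + L.+1)%N.
Hypotheses (r_gt0 : (0 < r)%N) (N_gt0 : (0 < N)%N) (pi_hook : is_hook r pi).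
Hypotheses (n_ge : (k.-1 * N.*2 <= n)%N) (eps_lt : eps * n%:R < N%:R).
Notation shift := {ffun 'I_L -> 'I_N}.

(** Extended by 0, so that the bound by [N] holds at every index. *)
Definition shift_fun (s : shift) (j : nat) : nat :=
  if insub j is Some i then s i else 0.

Lemma shift_fun_lt s j : (shift_fun s j < N)%N.
Proof. by rewrite /shift_fun; case: insubP => // i _ _; apply: ltn_ord. Qed.

Lemma shift_fun_ord s (j : 'I_L) : shift_fun s j = s j.
Proof. by rewrite /shift_fun valK. Qed.

Definition hard_input (s : shift) (x : 'I_n) : R :=
  (hard_value r L N (shift_fun s) x)%:R.

Lemma hard_input_far s : far_from_free pi eps (hard_input s).
Proof.
have slt := shift_fun_lt s.
have pos_lt (w : 'I_N) (m : 'I_k) : (hard_pos r N (shift_fun s) w m < n)%N.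
  exact: leq_trans (hard_pos_lt r_gt0 N_gt0 slt (ltn_ord w) (ltn_ord m)) n_ge.
apply: (@far_of_disjoint_copies _ _ _ _ _ _ 'I_N (fun w m => Ordinal (pos_lt w m))).
- move=> w; apply: is_copyP => a b /=; first exact: hard_pos_incr.
  rewrite /hard_input /= !hard_value_pos ?ltn_ord // ltr_nat !pi_hook /hook_val.
  move: ((_ - w) * _)%N => t.
  by have := ltn_ord a; have := ltn_ord b; do 6?case: ifP; lia.
- move=> w w' m m' [] eq_p; apply: val_inj.
  exact: (hard_pos_inj r_gt0 N_gt0 slt (ltn_ord w) (ltn_ord w') eq_p).
- by rewrite card_ord.
Qed.

(** By [hard_rigid], the positions of roles [r, ..., k - 1] of a copy determine the shift, so the
    caught shifts inject into the tuples of [L + 1] points of [Q]. *)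
Lemma card_caught (Q : {set 'I_n}) :
  (#|[set s | `[< copy_in pi (hard_input s) Q >]]| <= #|Q| ^ L.+1)%N.
Proof.
set A := [set s | _].
have tup s : exists g : {ffun 'I_L.+1 -> 'I_n}, s \in A -> (forall a, g a \in Q) /\
    forall j : 'I_L, (s j = N + g (lift ord0 j) %% N.*2 - (N.*2.-1 - (g ord0 %% N.*2)./2) :> nat)%N.
  have [|_] := boolP (s \in A); last first.
    have n_gt0 : (0 < n)%N by apply: leq_trans n_ge; rewrite muln_gt0 double_gt0 N_gt0; lia.
    by exists [ffun=> Ordinal n_gt0].
  rewrite inE => /asboolP[i [inc ord] iQ].
  have k_gt0 : (0 < k)%N by lia.
  pose role m : 'I_k := insubd (Ordinal k_gt0) m.
  have val_role m : (m < k)%N -> role m = m :> nat by move=> mk; rewrite val_insubd mk.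
  exists [ffun a : 'I_L.+1 => i (role (r + a)%N)] => _; split=> [a|j]; first by rewrite ffunE.
  rewrite !ffunE /= /bump /= add1n addn0 addnS -addSn -shift_fun_ord.
  have V_lt a b : (a < k)%N -> (b < k)%N -> (hook_val k r a < hook_val k r b)%N ->
      (hard_value r L N (shift_fun s) (i (role a)) < hard_value r L N (shift_fun s) (i (role b)))%N.
    move=> ak bk ab; rewrite -(ltr_nat R); apply/(ord (role a) (role b)).2.
    by rewrite !pi_hook !val_role.
  apply: (hard_rigid (L := L) r_gt0 N_gt0 (shift_fun_lt s) (P := fun m => i (role m)))
    => [m m' mm' m'k|m m' mm' m'r|m m' rm mm' m'k|m rm mk|].
  - by apply: inc; rewrite !val_role; lia.
  - by apply: V_lt; rewrite /hook_val; do ?case: ifP; lia.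
  - by apply: V_lt; rewrite /hook_val; do ?case: ifP; lia.
  - by apply: V_lt; rewrite /hook_val; do ?case: ifP; lia.
  - exact: ltn_ord.
have [g gP] := choice tup.
have g_inj : {in A &, injective g}.
  move=> s s' /gP[_ sE] /gP[_ s'E] eq_g; apply/ffunP => j; apply: val_inj.
  by rewrite /= sE s'E eq_g.
rewrite -(card_in_imset g_inj) -[X in (_ ^ X)%N](card_ord L.+1) -card_ffun_on.
apply/subset_leq_card/subsetP => x /imsetP[s /gP[gQ _] ->].
by apply/ffun_onP.
Qed.

(** Sum over all shifts: each of the [N ^ L] inputs is caught with probability at least [2 / 3],
    while a fixed query set catches at most [#|Q| ^ L.+1] of them. *)
Lemma query_lower_bound (T : nonadaptive_algorithm R n) : one_sided_test pi eps T ->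
  2 / 3 * (N ^ L)%:R <= (num_queries T ^ L.+1)%:R :> R.
Proof.
move=> Tos; have k_gt1 : (1 < k)%N by lia.
pose caught s Q : R := `[< copy_in pi (hard_input s) Q >]%:R.
have rej s : 2 / 3 <= \sum_Q query_prob T Q * caught s Q.
  apply: le_trans (Tos.2 _ (hard_input_far s)) _; apply: ler_sum => Q _.
  rewrite /caught; case: asboolP => [_|no].
    rewrite ler_wpM2l ?query_prob_ge0 //.
    by case/andP: (decision_prob T (fun i : {i : 'I_n | i \in Q} => hard_input s (val i))).
  have [->|pQ] := eqVneq (query_prob T Q) 0; first by rewrite !mul0r.
  by rewrite (decision_no_copy k_gt1 Tos pQ no).
have : \sum_(s : shift) 2 / 3 <= \sum_(s : shift) \sum_Q query_prob T Q * caught s Q.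
  exact: ler_sum.
rewrite sumr_const card_ffun !card_ord -[leLHS]mulr_natr => /le_trans; apply.
rewrite exchange_big /=.
apply: (@le_trans _ _ (\sum_Q query_prob T Q * (num_queries T ^ L.+1)%:R)); last first.
  by rewrite -mulr_suml query_prob_sum1 mul1r.
apply: ler_sum => Q _; rewrite -mulr_sumr.
have [->|pQ] := eqVneq (query_prob T Q) 0; first by rewrite !mul0r.
rewrite ler_wpM2l ?query_prob_ge0 //.
apply: (@le_trans _ _ (#|Q| ^ L.+1)%:R); last first.
  rewrite ler_nat leq_exp2r //.
  exact: (leq_bigmax_cond (P := fun Q => query_prob T Q != 0)
    (F := fun Q : {set 'I_n} => #|Q|)).
apply: le_trans (_ : #|[set s | `[< copy_in pi (hard_input s) Q >]]|%:R <= _); last first.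
  by rewrite ler_nat card_caught.
rewrite -sum1_card natr_sum [leRHS]big_mkcond /=; apply: ler_sum => s _.
by rewrite inE /caught; case: asbool.
Qed.
End LowerBound.

(** * Asymptotics *)

Section Asymptotics.
Variable R : realType.

(** Here [y] is the root of [x] of order [L + 1]; the identities trade real exponents for integer
    ones. *)
Lemma root_split (x : R) (L : nat) : 1 <= x -> exists2 y : R, 0 < y <= x &
  [/\ y ^+ L.+1 = x, x `^ (1 - L.+1%:R^-1) * y = x & (x `^ (1 - L.+1%:R^-1)) ^+ L.+1 = x ^+ L].
Proof.
move=> x_ge1; have x_gt0 : 0 < x by lra.
have l_neq0 : L.+1%:R != 0 :> R by rewrite pnatr_eq0.
exists (x `^ (L.+1%:R^-1)).
  by rewrite powR_gt0 //= ler1_powR // invf_le1 ?ltr0n // ler1n.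
have y_root : (x `^ L.+1%:R^-1) ^+ L.+1 = x.
  by rewrite -powR_mulrn ?powR_ge0 // -powRrM mulVf // powRr1 // ltW.
have split : x `^ (1 - L.+1%:R^-1) * x `^ (L.+1%:R^-1) = x.
  by rewrite -powRD ?subrK ?powRr1 ?ltW // (gt_eqF x_gt0) implybT.
split=> //; apply: (mulIf (lt0r_neq0 x_gt0)).
by rewrite -{2}y_root -exprMn split exprSr.
Qed.

Lemma ln2_ge : 1 / 2 <= ln 2 :> R.
Proof.
rewrite -ler_expR lnK ?posrE // -[leLHS]invrK -expRN.
have := expR_ge1Dx (- (1 / 2) : R) => le.
rewrite -[leRHS]invrK lef_pV2 ?posrE ?expR_gt0 //; lra.
Qed.

Lemma ln_ge1 (n : nat) : (4 <= n)%N -> 1 <= ln n%:R :> R.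
Proof.
move=> n4; apply: (@le_trans _ _ (ln (2 ^+ 2))); first by rewrite lnXn // mulr2n; have := ln2_ge; lra.
by rewrite ler_ln ?posrE ?exprn_gt0 ?ltr0n ?(leq_trans _ n4) // -natrX ler_nat.
Qed.

Lemma log2_le_ln (n : nat) : (4 <= n)%N -> (trunc_log 2 n).+1%:R <= 3 * ln n%:R :> R.
Proof.
move=> n4; have n_gt0 : (0 < n)%N by apply: leq_trans n4.
have : ln (2 ^+ trunc_log 2 n) <= ln n%:R :> R.
  by rewrite ler_ln ?posrE ?exprn_gt0 ?ltr0n // -natrX ler_nat trunc_logP.
rewrite lnXn // -[ln _ *+ _]mulr_natl => le_ln; rewrite -[leLHS]natr1; have ln_n := ln_ge1 n4.
have := ler_wpM2l (ler0n R (trunc_log 2 n)) ln2_ge; lra.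
Qed.

(** Take the integer part of the root; the factor 2 absorbs the rounding. *)
Lemma max_nat_root (x : R) (L : nat) : 1 <= x ->
  exists K', K'.+1%:R ^+ L.+1 <= x < (2 * K'.+1%:R) ^+ L.+1.
Proof.
move=> x_ge1.
have ex : exists m, x < m.+1%:R ^+ L.+1.
  exists (Num.bound x); apply: lt_le_trans (archi_boundP _) _; first by lra.
  by rewrite -natrX ler_nat (leq_trans (leqnSn _)) // -{1}[_.+1]expn1 leq_pexp2l.
case: (ex_minnP ex) => -[|m] lt_x m_min; first by rewrite expr1n in lt_x; lra.
exists m; apply/andP; split.
  by rewrite leNgt; apply/negP => /m_min; rewrite ltnn.
apply: lt_le_trans lt_x _; rewrite -natrM -!natrX ler_nat leq_exp2r //; lia.
Qed.

Lemma soft_upper (k r : nat) (pi : 'S_k) (q : nat -> R -> nat) :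
    (0 < r)%N -> (r < k)%N -> is_hook r pi -> optimal_query_complexity pi q ->
  exists2 C : R, 0 < C & forall (n : nat) (eps : R), (4 <= n)%N -> 0 < eps < 1 ->
    (q n eps)%:R <= C * (ln n%:R / eps) ^+ (2 * r).+1 * n%:R `^ (1 - (k - r)%:R^-1).
Proof.
move=> r_gt0 rk pi_hook q_opt.
pose D0 : R := 10 * k%:R * (18 * k%:R * r%:R) ^+ r.
have k0 : 0 < k%:R :> R by rewrite ltr0n (leq_trans _ rk).
have r0 : 0 < r%:R :> R by rewrite ltr0n.
have D0_gt0 : 0 < D0 by rewrite !mulr_gt0 // exprn_gt0 // !mulr_gt0.
exists (12 * r.+1%:R * D0); first exact: mulr_gt0 (mulr_gt0 (ltr0Sn _ _) (ltr0Sn _ _)) D0_gt0.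
move=> n eps n4 eps01.
have [T [[Tos Tmin] <-]] := q_opt n eps eps01; case/andP: eps01 => eps_gt0 eps_lt1.
have [L kE] : exists L, (k - r = L.+1)%N by exists (k - r).-1; lia.
rewrite kE; have n1 : 1 <= n%:R :> R by rewrite ler1n (leq_trans _ n4).
have [y /andP[y_gt0 y_le] [y_root + _]] := root_split L n1.
set g := _ `^ _ => gy; have g_ge0 : 0 <= g by exact: powR_ge0.
set lam := ln n%:R; have lam1 : 1 <= lam := ln_ge1 n4.
pose h := (trunc_log 2 n).+1; have h_le : h%:R <= 3 * lam := log2_le_ln n4.
have h0 : 0 < h%:R :> R by rewrite ltr0n.
(* Chosen so that [K ^ (k - r) <= n / D] is the hypothesis of [sampled_test]. The bound
   [h <= 3 * ln n] then leads to the constant [D0]. *)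
pose D := 10 * k%:R * (2 * k%:R * r%:R * h%:R ^+ 2) ^+ r / eps ^+ r.+1.
have D_gt0 : 0 < D by rewrite divr_gt0 ?mulr_gt0 ?exprn_gt0 // !mulr_gt0 // exprn_gt0.
have D_le : D <= D0 * (lam / eps) ^+ (2 * r).+1.
  have -> : D0 * (lam / eps) ^+ (2 * r).+1 =
      10 * k%:R * (2 * k%:R * r%:R * (3 * lam) ^+ 2) ^+ r * lam / eps ^+ (2 * r).+1.
    have -> : 2 * k%:R * r%:R * (3 * lam) ^+ 2 = 18 * k%:R * r%:R * lam ^+ 2 by ring.
    rewrite /D0 expr_div_n [lam ^+ (2 * r).+1]exprSr [lam ^+ (2 * r)]exprM [in RHS]exprMn.
    by rewrite !mulrA.
  rewrite /D ler_pM ?invr_ge0 ?exprn_ge0 ?(ltW eps_gt0) //.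
  - by rewrite !mulr_ge0 // exprn_ge0 // !mulr_ge0 // exprn_ge0.
  - rewrite -[leLHS]mulr1 ler_pM // ?ler_wpM2l ?mulr_ge0 ?exprn_ge0 ?mulr_ge0 ?exprn_ge0 //.
    by rewrite lerXn2r ?nnegrE ?mulr_ge0 ?exprn_ge0 ?ler_wpM2l ?mulr_ge0 ?lerXn2r ?nnegrE //; lra.
  - rewrite lef_pV2 ?posrE ?exprn_gt0 // ler_wiXn2l ?(ltW eps_gt0) ?(ltW eps_lt1) //.
    by rewrite ltnS mul2n -addnn leq_addr.
have D_ge1 : 1 <= D.
  rewrite /D ler_pdivlMr ?exprn_gt0 // mul1r; apply: (@le_trans _ _ 1).
    by rewrite exprn_ile1 // ltW.
  have k1 : 1 <= k%:R :> R by rewrite ler1n (leq_trans _ rk).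
  have r1 : 1 <= r%:R :> R by rewrite ler1n.
  have h1 : 1 <= h%:R ^+ 2 :> R by rewrite exprn_ege1 // ler1n.
  rewrite -[leLHS]mulr1 ler_pM //; first by lra.
  apply: exprn_ege1; rewrite -[leLHS]mulr1 ler_pM // -[leLHS]mulr1 ler_pM //; lra.
suff le_D : (num_queries T)%:R <= 12 * r.+1%:R * D * g.
  apply: le_trans le_D _; rewrite ler_wpM2r // -[leRHS]mulrA ler_wpM2l // mulr_ge0 //.
(* If [n < D], querying everything is cheap enough, since [n = g * y] and [y <= n < D]. *)
have [D_big|D_small] := ltP (n%:R) D.
  have [T' [T'os T'n]] := full_query_test n pi eps_gt0.
  have : (num_queries T)%:R <= n%:R :> R by rewrite ler_nat (leq_trans (Tmin _ T'os)).
  move/le_trans; apply; rewrite -gy mulrC ler_wpM2r //.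
  apply: (@le_trans _ _ D); first by lra.
  by apply: ler_peMl; [exact: ltW|rewrite -natrM ler1n].
have [|K' /andP[K_le K_gt]] := @max_nat_root (n%:R / D) L.
  by rewrite ler_pdivlMr ?mul1r.
have [T' [T'os T'q]] : exists T' : nonadaptive_algorithm R n,
    one_sided_test pi eps T' /\ (num_queries T' <= 6 * n * r.+1 %/ K'.+1)%N.
  have n_h : (n <= 2 ^ h)%N by rewrite ltnW // trunc_log_ltn.
  have K_small : 5 * K'.+1%:R ^+ (k - r) <=
      (eps / (2 * k%:R * r%:R * h%:R ^+ 2)) ^+ r * (eps * n%:R / (2 * k%:R)).
    rewrite kE; apply: (@le_trans _ _ (5 * (n%:R / D))); first by rewrite ler_wpM2l.
    rewrite le_eqVlt; apply/orP; left; apply/eqP; rewrite /D expr_div_n [eps ^+ r.+1]exprS.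
    have := exprn_gt0 r eps_gt0; move: (eps ^+ r) => e e_gt0.
    have : 0 < (2 * k%:R * r%:R * h%:R ^+ 2) ^+ r :> R by rewrite exprn_gt0 // !mulr_gt0 // ?exprn_gt0.
    move: (_ ^+ r) => B B_gt0; field.
    by rewrite !gt_eqF.
  case: (n) n4 n_h K_small => [//|n'] _ n_h K_small.
  exact: (sampled_test r_gt0 rk pi_hook (ltn0Sn _) n_h eps_gt0 K_small).
have : (num_queries T)%:R <= (6 * n * r.+1)%:R / K'.+1%:R :> R.
  rewrite ler_pdivlMr ?ltr0n // -natrM ler_nat.
  apply: leq_trans (leq_divM _ K'.+1); rewrite leq_mul2r; apply/orP; right.
  exact: leq_trans (Tmin _ T'os) T'q.
move/le_trans; apply; rewrite ler_pdivrMr ?ltr0n //.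
have y_le_KD : y <= 2 * K'.+1%:R * D.
  have K0 : 0 <= 2 * K'.+1%:R :> R by rewrite mulr_ge0.
  have KD_ge0 : 0 <= 2 * K'.+1%:R * D by rewrite mulr_ge0 // ltW.
  suff : y ^+ L.+1 <= (2 * K'.+1%:R * D) ^+ L.+1.
    by rewrite ler_pXn2r // nnegrE ltW.
  rewrite y_root exprMn; apply: (@le_trans _ _ ((2 * K'.+1%:R) ^+ L.+1 * D)).
    by rewrite ltW // -ltr_pdivrMr.
  by rewrite ler_wpM2l ?exprn_ge0 // exprS ler_peMr ?exprn_ege1 // ltW.
rewrite !natrM -gy.
have := ler_wpM2l (mulr_ge0 (mulr_ge0 (ler0n R 6) g_ge0) (ler0n R r.+1)) y_le_KD.
lra.
Qed.

Lemma soft_lower (r L : nat) (pi : 'S_(r + L.+1)) (q : nat -> R -> nat)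
    (k := (r + L.+1)%N) :
    (0 < r)%N -> is_hook r pi -> optimal_query_complexity pi q ->
  forall (n : nat) (eps : R), (2 * k <= n)%N -> 0 < eps <= 1 / (8 * k%:R) ->
    n%:R `^ (1 - L.+1%:R^-1) <= 8 * k%:R * (q n eps)%:R :> R.
Proof.
move=> r_gt0 pi_hook q_opt n eps n_ge /andP[eps_gt0 eps_le].
have k_gt1 : (1 < k)%N by rewrite /k; lia.
have k1 : 1 <= k%:R :> R by rewrite ler1n ltnW.
have eps_lt1 : eps < 1.
  apply: le_lt_trans eps_le _; rewrite ltr_pdivrMr; lra.
have [|T [[Tos _] <-]] := q_opt n eps; first by rewrite eps_gt0.
have n1 : 1 <= n%:R :> R by rewrite ler1n; lia.
have [_ _ [_ _ ]] := root_split L n1; set g := _ `^ _ => g_pow.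
have g_ge0 : 0 <= g by exact: powR_ge0.
(* The largest [N] that fits into the domain. It is at least [n / (4 * k)], so the hard inputs are
   far for [eps <= 1 / (8 * k)]. *)
pose N := (n %/ (2 * k.-1))%N.
have k'_gt0 : (0 < 2 * k.-1)%N by lia.
have N_gt0 : (0 < N)%N by rewrite divn_gt0 //; lia.
have N_le : (k.-1 * N.*2 <= n)%N.
  by have := leq_divM n (2 * k.-1); rewrite -/N -muln2; lia.
have n_le : (n <= 4 * k * N)%N.
  have := ltn_ceil n k'_gt0; rewrite -/N => lt_n.
  apply: leq_trans (ltnW lt_n) _; nia.
have n_leR : n%:R <= 4 * k%:R * N%:R :> R by rewrite -!natrM ler_nat.
have N1 : 1 <= N%:R :> R by rewrite ler1n.
have eps_n : eps * n%:R < N%:R.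
  apply: (@le_lt_trans _ _ (1 / (8 * k%:R) * (4 * k%:R * N%:R))).
    by rewrite ler_pM // ltW.
  rewrite (_ : _ * _ = N%:R / 2); last by field; lra.
  lra.
have := query_lower_bound r_gt0 N_gt0 pi_hook N_le eps_n Tos.
rewrite !natrX; set Q := (num_queries T)%:R => lower.
have Q_ge0 : 0 <= Q by exact: ler0n.
suff : g ^+ L.+1 <= (8 * k%:R * Q) ^+ L.+1.
  by rewrite ler_pXn2r // nnegrE mulr_ge0 //; lra.
rewrite g_pow; apply: (@le_trans _ _ ((4 * k%:R * N%:R) ^+ L)).
  by rewrite lerXn2r ?nnegrE // !mulr_ge0 // ler0n.
rewrite !exprMn; set NL := N%:R ^+ L in lower *.
have pow_le : 4 ^+ L * k%:R ^+ L * (3 / 2) <= 8 ^+ L.+1 * k%:R ^+ L.+1 :> R.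
  rewrite mulrAC ler_pM ?exprn_ge0 // ?mulr_ge0 ?exprn_ge0 //; first by lra.
    rewrite exprSr ler_pM ?exprn_ge0 ?lerXn2r ?nnegrE //; lra.
  by rewrite exprS ler_peMl ?exprn_ge0 // ler0n.
apply: (@le_trans _ _ (4 ^+ L * k%:R ^+ L * (3 / 2) * Q ^+ L.+1)).
  rewrite -[leRHS]mulrA ler_wpM2l ?mulr_ge0 ?exprn_ge0 //; lra.
by rewrite ler_wpM2r // exprn_ge0.
Qed.

End Asymptotics.

Theorem theorem3p12 (R : realType) (k l : nat) (hk : (2 <= k)%N)
    (hl : (1 <= l <= k - 1)%N) :
  exists pi : 'S_k,
    max_jump pi = l /\
    exists q : nat -> R -> nat,
      optimal_query_complexity pi q /\
      soft_Theta_eps q (fun n : nat => n%:R `^ (1 - l%:R^-1)).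
Proof.
have [r [L [r_gt0 kE lE]]] : exists r L, [/\ (0 < r)%N, k = (r + L.+1)%N & l = L.+1].
  by exists (k - l)%N, l.-1; split; lia.
subst k l; have [pi pi_hook] := hook_exists (leq_addr L.+1 r).
have rk : (r < r + L.+1)%N by lia.
exists pi; split; first by rewrite (max_jump_hook _ pi_hook) ?r_gt0 // addKn.
have [q q_opt] := optimal_complexity_exists R pi hk; exists q; split=> //.
have [C C_gt0 upper] := soft_upper r_gt0 rk pi_hook q_opt.
have lower := soft_lower r_gt0 pi_hook q_opt.
set k := (r + L.+1)%N in hk lower.
have k_gt0 : 0 < k%:R :> R by rewrite ltr0n ltnW.
have k1 : 1 <= k%:R :> R by rewrite ler1n ltnW.
have g_ge0 (n : nat) : 0 <= n%:R `^ (1 - L.+1%:R^-1) :> R by exact: powR_ge0.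
have log_ge1 (n : nat) (eps : R) : (4 <= n)%N -> 0 < eps < 1 ->
    1 <= (ln n%:R / eps) ^+ (2 * r).+1.
  move=> n4 /andP[eps_gt0 eps_lt1]; apply: exprn_ege1.
  by rewrite ler_pdivlMr // mul1r (le_trans (ltW eps_lt1)) ?ln_ge1.
(* One constant serves both directions; the lower bound admits the logarithmic factor, which is at
   least 1 for [n >= 4]. *)
exists (C + 8 * k%:R), (1 / (8 * k%:R)), (2 * r).+1, (maxn 4 (2 * k)); split.
- lra.
- rewrite divr_gt0 ?mulr_gt0 //= ltr_pdivrMr; lra.
- move=> n eps; rewrite geq_max => /andP[n4 _] eps01.
  have := upper n eps n4 eps01; rewrite addKn => /le_trans; apply.
  rewrite ler_wpM2r // ler_wpM2r ?(le_trans ler01) ?log_ge1 //; lra.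
- move=> n eps; rewrite geq_max => /andP[n4 nk] eps_small.
  apply: le_trans (lower n eps nk eps_small) _; rewrite ler_wpM2r //.
  have /andP[eps_gt0 eps_le] := eps_small.
  have eps01 : 0 < eps < 1.
    rewrite eps_gt0; apply: le_lt_trans eps_le _; rewrite ltr_pdivrMr; lra.
  apply: (@le_trans _ _ (C + 8 * k%:R)); first by lra.
  rewrite ler_peMr ?log_ge1 //; lra.
Qed.
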